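(* Let $\Lambda$ be an Artin algebra, let $X$ be an additive generator in $\operatorname{mod}(\Lambda)$, let $F:=F_{\operatorname{add}(X)}$, and let $\mathcal{T}\subseteq\operatorname{mod}(\Lambda)$. The following statements are equivalent. (a) The class $\mathcal{T}$ is $F$-preenveloping and $F$-torsion. (b) There is an $F$-tilting $T\in\operatorname{mod}(\Lambda)$ such that $\mathcal{T}=\operatorname{gen}_F(T)$. Moreover, the map $T\mapsto\operatorname{gen}_F(T)$ is a bijection between the isomorphism classes of basic $F$-tilting $\Lambda$-modules and the classes $\mathcal{T}\subseteq\operatorname{mod}(\Lambda)$ which are $F$-torsion and $F$-preenveloping.
   Context: $\operatorname{mod}(\Lambda)$ is the category of finitely generated left $\Lambda$-modules. $\operatorname{add}(M)$ is the class of direct summands of finite direct sums of copies of $M$; $\operatorname{gen}(M)$ is the class of epimorphic images of finite direct sums of copies of $M$. An additive generator in $\operatorname{mod}(\Lambda)$ is a module $X$ with $\operatorname{gen}(X)=\operatorname{mod}(\Lambda)$. A nonzero module is basic if the summands in its decomposition into indecomposables are pairwise non-isomorphic. For a class $\mathcal{X}\subseteq\operatorname{mod}(\Lambda)$, $F_{\mathcal{X}}$ is the additive subfunctor of $\operatorname{Ext}^1_\Lambda$ such that $F_{\mathcal X}(C,A)$ consists of the exact sequences $\eta:0\to A\to B\to C\to 0$ with $\operatorname{Hom}_\Lambda(Z,\eta)$ exact for all $Z\in\mathcal{X}$. For an additive subfunctor $F\subseteq\operatorname{Ext}^1_\Lambda$, an exact sequence $0\to A\to B\to C\to 0$ is $F$-exact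 if it lies in $F(C,A)$; then $C$ is called an $F$-quotient of $B$. $\mathcal{P}(F)$ is the class of $F$-projective modules, i.e. modules $P$ such that $\operatorname{Hom}_\Lambda(P,\eta)$ is exact for every $F$-exact $\eta$. For $F=F_{\operatorname{add}(X)}$ with $X$ an additive generator, $F$ has enough projectives and injectives and $\mathcal{P}(F)=\operatorname{add}(X)$. $\operatorname{Ext}^i_F(M,N)$ is the $i$-th cohomology of $\operatorname{Hom}_\Lambda(P_\bullet,N)$, where $P_\bullet$ is an $F$-projective resolution of $M$ (a resolution by $F$-projectives whose constituent short exact sequences are $F$-exact), and $\operatorname{pd}_F(M)$ is the minimal length of an $F$-projective resolution of $M$. $T\in\operatorname{mod}(\Lambda)$ is $F$-tilting if $\operatorname{pd}_F(T)\le 1$, $\operatorname{Ext}^i_F(T,T)=0$ for all $i>0$, and for any $Q\in\mathcal{P}(F)$ there is an $F$-exact sequence $0\to Q\to T_0\to T_1\to 0$ with $T_0,T_1\in\operatorname{add}(T)$. $\operatorname{gen}_F(T)$ is the class of all $Z\in\operatorname{mod}(\Lambda)$ for which there is an $F$-exact sequence $0\to K\to Y\to Z\to 0$ with $Y$ a finite direct sum of copies of $T$. A class $\mathcal{T}$ is $F$-torsion if it is closed under $F$-extensions (if $0\to A\to B\to C\to 0$ is $F$-exact with $A,C\in\mathcal{T}$ then $B\in\mathcal{T}$) and under $F$-quotients. A $\mathcal{T}$-preenvelope of $M$ is a morphism $f:M\to T'$ with $T'\in\mathcal{T}$ such that $\operatorname{Hom}_\Lambda(f,Z)$ is surjective for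 all $Z\in\mathcal{T}$. $\mathcal{T}$ is $F$-preenveloping if each $M\in\operatorname{mod}(\Lambda)$ admits an $F$-exact sequence $0\to M\xrightarrow{f}T'\to N\to 0$ with $f$ a $\mathcal{T}$-preenvelope. *)

(* Defs.v *)
From HB Require Import structures.
From mathcomp Require Import all_boot all_order all_algebra.

Set Implicit Arguments.
Unset Strict Implicit.
Unset Printing Implicit Defensive.

Import GRing.Theory.
Local Open Scope ring_scope.

Definition surjective (U V : Type) (f : U -> V) : Prop :=
  forall y, exists x, f x = y.

Definition fin_gen (R : nzRingType) (M : lmodType R) : Prop :=
  exists (n : nat) (e : 'I_n -> M),
    forall x, exists c : 'I_n -> R, x = \sum_(i < n) c i *: e i.

Definition is_ideal (k : comNzRingType) (I : k -> Prop) : Prop :=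
  I 0 /\ forall a x y, I x -> I y -> I (a * x + y).

Definition artinian (k : comNzRingType) : Prop :=
  forall I : nat -> k -> Prop,
    (forall n, is_ideal (I n)) ->
    (forall n x, I n.+1 x -> I n x) ->
    exists N, forall n x, (N <= n)%N -> (I n x <-> I N x).

(* The axioms of [algType k] make the image of [k] central; [A] is also
   nontrivial, being an [nzRingType]. *)
Definition artin_algebra (k : comNzRingType) (A : algType k) : Prop :=
  artinian k /\ fin_gen (A : lmodType k).

Section Modules.

Variable A : nzRingType.
Implicit Types M N P Q T X Z : lmodType A.

Definition isomorphic M N : Prop := exists f : {linear M -> N}, bijective f.

Definition zero_module M : Prop := forall x : M, x = 0.

Definition copies (n : nat) M : lmodType A := {ffun 'I_n -> M}.

(* The map from the external direct sum of the [N i] to [M] induced by the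
   [e i] is bijective. *)
Definition is_direct_sum (n : nat) (N : 'I_n -> lmodType A) M : Prop :=
  exists e : forall i, {linear N i -> M},
    (forall x : M, exists y : forall i, N i, x = \sum_(i < n) e i (y i)) /\
    (forall y : forall i, N i,
        \sum_(i < n) e i (y i) = 0 -> forall i, y i = 0).

Definition indecomposable M : Prop :=
  ~ zero_module M /\
  forall N N', isomorphic (N * N')%type M -> zero_module N \/ zero_module N'.

Definition basic M : Prop :=
  ~ zero_module M /\
  exists (n : nat) (N : 'I_n -> lmodType A),
    [/\ is_direct_sum N M,
        forall i, indecomposable (N i) &
        forall i j, isomorphic (N i) (N j) -> i = j].

Definition modclass := lmodType A -> Prop.

Definition add_class M : modclass :=
  fun N => exists (n : nat) (N' : lmodType A),
    isomorphic (N * N')%type (copies n M).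

Definition gen_class M : modclass :=
  fun N => exists (n : nat) (p : {linear copies n M -> N}), surjective p.

Definition additive_generator X : Prop :=
  fin_gen X /\ forall M, gen_class X M <-> fin_gen M.

Definition short_exact (U V W : lmodType A)
    (f : {linear U -> V}) (g : {linear V -> W}) : Prop :=
  [/\ injective f, forall v, g v = 0 <-> exists u, f u = v & surjective g].

(* Exactness of 0 -> Hom(Z,U) -> Hom(Z,V) -> Hom(Z,W) -> 0. *)
Definition hom_exact Z (U V W : lmodType A)
    (f : {linear U -> V}) (g : {linear V -> W}) : Prop :=
  [/\ forall u u' : {linear Z -> U}, f \o u =1 f \o u' -> u =1 u',
      forall v : {linear Z -> V},
        (forall z, g (v z) = 0) <-> exists u : {linear Z -> U}, f \o u =1 v &
      forall w : {linear Z -> W}, exists v : {linear Z -> V}, g \o v =1 w].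

(* A subfunctor of Ext^1 is given by the exact sequences
   0 -> U -> V -> W -> 0 in mod(A) whose classes it contains. *)
Definition exact_structure :=
  forall U V W : lmodType A, {linear U -> V} -> {linear V -> W} -> Prop.

Definition F_of (C : modclass) : exact_structure :=
  fun U V W f g =>
    [/\ fin_gen U, fin_gen V, fin_gen W, short_exact f g &
        forall Z, C Z -> hom_exact Z f g].

Section Relative.

Variable F : exact_structure.

Definition F_projective P : Prop :=
  fin_gen P /\
  forall (U V W : lmodType A) (f : {linear U -> V}) (g : {linear V -> W}),
    F f g -> hom_exact P f g.

(* An F-projective resolution, spliced from the F-exact sequences
   0 -> rsyz 0 -> rterm 0 -> M -> 0 and
   0 -> rsyz n.+1 -> rterm n.+1 -> rsyz n -> 0. *)
Record F_resolution M := FResolution {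
  rterm : nat -> lmodType A;
  rsyz : nat -> lmodType A;
  rincl : forall n, {linear rsyz n -> rterm n};
  raug : {linear rterm 0 -> M};
  rcover : forall n, {linear rterm n.+1 -> rsyz n};
  term_projective : forall n, F_projective (rterm n);
  aug_exact : F (rincl 0) raug;
  cover_exact : forall n, F (rincl n.+1) (rcover n) }.

Definition rdiff M (P : F_resolution M) (n : nat) :
    {linear rterm P n.+1 -> rterm P n} :=
  rincl P n \o rcover P n.

Definition pd_le M (n : nat) : Prop :=
  exists P : F_resolution M, forall i, (n < i)%N -> zero_module (rterm P i).

Definition cocycle M (P : F_resolution M) N i (f : {linear rterm P i -> N}) :
    Prop :=
  forall x, f (rdiff P i x) = 0.

Definition coboundary M (P : F_resolution M) N i :
    {linear rterm P i -> N} -> Prop :=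
  match i with
  | 0 => fun f => forall x, f x = 0
  | j.+1 => fun f =>
      exists g : {linear rterm P j -> N}, f =1 g \o rdiff P j
  end.

(* Ext^i_F(M, N) = 0.  The cohomology does not depend on the resolution up to
   isomorphism, so it is required to vanish for each of them. *)
Definition Ext_vanishes i M N : Prop :=
  forall (P : F_resolution M) (f : {linear rterm P i -> N}),
    cocycle f -> coboundary f.

Definition F_tilting T : Prop :=
  [/\ fin_gen T,
      pd_le T 1,
      forall i, (0 < i)%N -> Ext_vanishes i T T &
      forall Q, F_projective Q ->
        exists (T0 T1 : lmodType A)
               (f : {linear Q -> T0}) (g : {linear T0 -> T1}),
          [/\ add_class T T0, add_class T T1 & F f g]].

Definition gen_F T : modclass :=
  fun Z => exists (n : nat) (K : lmodType A)
      (f : {linear K -> copies n T}) (g : {linear copies n T -> Z}), F f g.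

Definition F_torsion (C : modclass) : Prop :=
  (forall (U V W : lmodType A) (f : {linear U -> V}) (g : {linear V -> W}),
      F f g -> C U -> C W -> C V) /\
  (forall (U V W : lmodType A) (f : {linear U -> V}) (g : {linear V -> W}),
      F f g -> C V -> C W).

Definition preenvelope (C : modclass) M T (f : {linear M -> T}) : Prop :=
  C T /\
  forall Z, C Z -> forall h : {linear M -> Z},
    exists h' : {linear T -> Z}, h' \o f =1 h.

Definition F_preenveloping (C : modclass) : Prop :=
  forall M, fin_gen M ->
    exists (T N : lmodType A) (f : {linear M -> T}) (g : {linear T -> N}),
      F f g /\ preenvelope C f.

End Relative.

Definition in_mod (C : modclass) : Prop := forall M, C M -> fin_gen M.

Definition same_class (C D : modclass) : Prop := forall M, C M <-> D M.

End Modules.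

(* Main.v *)
Require Import Defs.
From HB Require Import structures.
From mathcomp Require Import all_boot all_order all_algebra.
From mathcomp Require Import boolp.

Set Implicit Arguments.
Unset Strict Implicit.
Unset Printing Implicit Defensive.

Import GRing.Theory.
Local Open Scope ring_scope.

(** An F-exact sequence, for F = F_(add X), is a short exact sequence of finitely
    generated modules along whose epimorphism every map from [X] lifts; the
    modules in add X are F-projective and Ext^1_F(M, N) = 0 means that maps from
    [M] lift along every F-exact sequence with kernel [N] ([Ext1_zero]).

    _From a class to a tilting module._  Let C be F-torsion and F-preenveloping,
    and let 0 -> Q -> S -> N -> 0 be F-exact, with Q F-projective and Q -> S a
    C-preenvelope that is minimal, i.e. every endomorphism of S under Q is
    bijective.  A map r from S to the end term of an F-exact sequence with
    kernel Z in C pulls that sequence back to an extension G of S by Z.  G lies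
    in C, so any map Q -> G over S extends to S -> G, and minimality corrects it
    into a section ([minimal_lift]).  Hence r lifts, with a prescribed value on
    Q; choosing that value well, S and N are both Ext-projective in C
    ([minimal_ext_projective], a form of Wakamatsu's lemma).  For Q = X the sum
    of S and N also generates C, because a cover X^n -> Z with Z in C extends
    to S^n -> Z.

    An Ext-projective T of C has pd_F(T) <= 1.  Let K be the kernel of an
    F-epimorphism from an F-projective P onto T, and let h : K -> W be a map
    into the end of an F-exact sequence 0 -> U -> V -> W -> 0.  Embed V by an
    F-monomorphism into some E in C.  Then W embeds in E/U, which lies in C, so
    h followed by this embedding extends to P -> E/U, lifts to P -> E, and on K
    takes values in V: this is the lift of h ([F_kernel_projective]).  The
    argument replaces the usual one with F-injectives.  The conditions on
    Ext_F(T, T) follow, and [tilting_criterion] collects them.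

    _From a tilting module to a class._  If T is F-tilting then the kernel of
    an F-projective cover of T is F-projective, so Ext^1_F(T, -) vanishes on
    gen_F(T) ([tilting_Ext1_zero_gen]).  Covers T^m -> W therefore lift through
    F-extensions, which makes gen_F(T) closed under them, and the pushout of
    0 -> X^n -> T0 -> T1 -> 0 along a cover X^n -> M is a preenvelope of M.

    _Bijectivity._  The class determines add T, the class of its own
    Ext-projective members ([ext_projective_add]); and by the Krull-Schmidt
    theorem a basic module is determined by the summands of its powers
    ([basic_add_isomorphic]), while every nonzero module has a basic one with
    the same such summands ([ex_basic_part]).

    The finiteness needed is that finitely generated modules satisfy both chain
    conditions and that finitely generated modules of homomorphisms provide
    covers.  It comes from the theorem that a commutative Artinian ring is
    Noetherian ([artinian_noetherian]). *)

(** * Submodules and quotient modules *)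

Lemma ex_choice (T U : Type) (P : T -> U -> Prop) :
  (forall x, exists y, P x y) -> exists f : T -> U, forall x, P x (f x).
Proof. by move=> /choice[f hf]; exists f. Qed.

Section LinearTools.
Variables (R : nzRingType).
Implicit Types U V W : lmodType R.

Definition mklin U V (f : U -> V) (fL : linear f) : {linear U -> V} :=
  HB.pack f (GRing.isLinear.Build R U V *:%R f fL).

Definition is_submodule V (S : V -> Prop) : Prop :=
  S 0 /\ forall a x y, S x -> S y -> S (a *: x + y).

Section Submodule.
Variables (V : lmodType R) (S : V -> Prop).

Lemma submodD x y : is_submodule S -> S x -> S y -> S (x + y).
Proof. by move=> [_ h] Sx Sy; rewrite -[x]scale1r; apply: h. Qed.

Lemma submodZ a x : is_submodule S -> S x -> S (a *: x).
Proof. by move=> [h0 h] Sx; rewrite -[_ *: _]addr0; apply: h. Qed.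

Lemma submodN x : is_submodule S -> S x -> S (- x).
Proof. by move=> h Sx; rewrite -scaleN1r; apply: submodZ. Qed.

Lemma submodB x y : is_submodule S -> S x -> S y -> S (x - y).
Proof. by move=> h Sx Sy; apply: submodD => //; apply: submodN. Qed.

Hypothesis hS : is_submodule S.

Definition submem : {pred V} := fun x => `[< S x >].

Lemma submem_closed : submod_closed submem.
Proof.
split; first by apply/asboolP; case: hS.
move=> a x y /asboolP Sx /asboolP Sy; apply/asboolP.
by case: hS => _; apply.
Qed.

HB.instance Definition _ :=
  GRing.isSubmodClosed.Build R V submem submem_closed.

Definition submodule : Type := {x : V | x \in submem}.
HB.instance Definition _ := SubChoice.on submodule.
HB.instance Definition _ := [SubChoice_isSubLmodule of submodule by <:].

(** Submodules and quotients are only used through these two existence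
    statements, which hide the underlying subtype and quotient type. *)
Lemma ex_submodule : exists (U : lmodType R) (i : {linear U -> V}),
  injective i /\ forall x, S x <-> exists u, i u = x.
Proof.
exists (submodule : lmodType R), (val : {linear submodule -> V}).
split; first exact: val_inj.
move=> x; split=> [Sx|[u <-]].
  have xS : x \in submem by apply/asboolP.
  by exists (exist _ x xS : submodule).
by apply/asboolP; exact: (valP u).
Qed.

Definition quotmod : Type := Quotient.quot submem.
HB.instance Definition _ := GRing.Zmodule.on quotmod.

Local Open Scope quotient_scope.

Definition quot_pi (x : V) : quotmod := \pi_quotmod x.

Lemma quot_pi_repr (q : quotmod) : quot_pi (repr q) = q.
Proof. exact: reprK. Qed.

Lemma quot_pi_eq (x y : V) : quot_pi x = quot_pi y <-> S (x - y).
Proof.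
split=> [/eqP|Sxy].
  by rewrite /quot_pi -Quotient.idealrBE => /asboolP.
by apply/eqP; rewrite -Quotient.idealrBE; apply/asboolP.
Qed.

Lemma quot_piD (x y : V) : quot_pi (x + y) = quot_pi x + quot_pi y.
Proof. exact: (raddfD (\pi_(Quotient.quot submem) : {additive _ -> _})). Qed.

Definition quotscale (a : R) (q : quotmod) : quotmod := quot_pi (a *: repr q).

Lemma quotscaleE a x : quotscale a (quot_pi x) = quot_pi (a *: x).
Proof.
apply/quot_pi_eq; rewrite -scalerBr; apply: submodZ => //.
by apply/quot_pi_eq; rewrite quot_pi_repr.
Qed.

Lemma quotscaleA a b q : quotscale a (quotscale b q) = quotscale (a * b) q.
Proof. by rewrite -[q]quot_pi_repr !quotscaleE scalerA. Qed.

Lemma quotscale1 : left_id 1 quotscale.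
Proof. by move=> q; rewrite -[q]quot_pi_repr quotscaleE scale1r. Qed.

Lemma quotscaleDr : right_distributive quotscale +%R.
Proof.
move=> a p q; rewrite -[q]quot_pi_repr -[p]quot_pi_repr -quot_piD.
by rewrite !quotscaleE scalerDr quot_piD.
Qed.

Lemma quotscaleDl q : {morph quotscale^~ q : a b / a + b}.
Proof. by move=> a b; rewrite -[q]quot_pi_repr !quotscaleE scalerDl quot_piD. Qed.

HB.instance Definition _ := GRing.Zmodule_isLmodule.Build R quotmod
  quotscaleA quotscale1 quotscaleDr quotscaleDl.

Lemma ex_quotient : exists (W : lmodType R) (p : {linear V -> W}),
  surjective p /\ forall x, p x = 0 <-> S x.
Proof.
have pL : linear quot_pi by move=> a x y; rewrite quot_piD -quotscaleE.
exists (quotmod : lmodType R), (mklin pL); split.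
  by move=> q; exists (repr q); rewrite /= quot_pi_repr.
move=> x; have -> : (0 : quotmod) = quot_pi 0.
  by apply: (@addrI _ (quot_pi 0)); rewrite -quot_piD !addr0.
by rewrite quot_pi_eq subr0.
Qed.

End Submodule.
End LinearTools.

(** * Chain conditions *)

Section Span.
Variable (R : nzRingType).
Implicit Types V W : lmodType R.

(** Recursion on the generators makes inductions on their number immediate. *)
Fixpoint lspan V (e : seq V) (x : V) : Prop :=
  if e is v :: e' then exists c y, lspan e' y /\ x = c *: v + y else x = 0.

Lemma lspan_submod V (e : seq V) : is_submodule (lspan e).
Proof.
elim: e => [|v e [IH0 IH]] /=; first by split=> // a x y -> ->; rewrite scaler0 addr0.
split; first by exists 0, 0; rewrite scale0r addr0.
move=> a x y [c [x' [Sx' ->]]] [d [y' [Sy' ->]]].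
exists (a * c + d), (a *: x' + y'); split; first exact: IH.
by rewrite scalerDr scalerDl scalerA addrACA.
Qed.

Lemma lspan_mem V (e : seq V) v : v \in e -> lspan e v.
Proof.
elim: e => //= w e IH; rewrite inE => /orP[/eqP ->|/IH h].
  by exists 1, 0; rewrite scale1r addr0; split=> //; case: (lspan_submod e).
by exists 0, v; rewrite scale0r add0r.
Qed.

Lemma lspan_min V (S : V -> Prop) (e : seq V) : is_submodule S ->
  (forall v, v \in e -> S v) -> forall x, lspan e x -> S x.
Proof.
move=> hS; elim: e => /= [_ x ->|v e IH he x [c [y [hy ->]]]]; first by case: hS.
apply: submodD => //; first by apply: submodZ => //; apply: he; rewrite mem_head.
by apply: IH => // w we; apply: he; rewrite inE we orbT.
Qed.

Lemma lspan_subset V (e e' : seq V) :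
  {subset e <= e'} -> forall x, lspan e x -> lspan e' x.
Proof.
by move=> h; apply: lspan_min; [exact: lspan_submod|move=> v /h /lspan_mem].
Qed.

Lemma lspan_sum V (e : seq V) x : lspan e x ->
  exists c : 'I_(size e) -> R, x = \sum_i c i *: e`_i.
Proof.
elim: e x => /= [x ->|v e IH x [a [y [/IH[c ->] ->]]]].
  by exists (fun=> 0); rewrite big_ord0.
exists (fun i => if unlift ord0 i is Some j then c j else a).
rewrite big_ord_recl unlift_none; congr (_ + _).
by apply: eq_bigr => i _; rewrite liftK.
Qed.

Lemma lspan_of_sum V n (e : 'I_n -> V) (c : 'I_n -> R) :
  lspan (codom e) (\sum_i c i *: e i).
Proof.
have [h0 _] := lspan_submod (codom e).
apply: (big_ind (fun x => lspan (codom e) x)) => // [x y|i _].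
  by apply: submodD; exact: lspan_submod.
apply: submodZ; first exact: lspan_submod.
by apply: lspan_mem; exact: codom_f.
Qed.

Lemma fin_gen_span V : fin_gen V <-> exists e : seq V, forall x, lspan e x.
Proof.
split=> [[n [e he]]|[e he]].
  by exists (codom e) => x; have [c ->] := he x; exact: lspan_of_sum.
exists (size e), (fun i => e`_i) => x; exact: lspan_sum.
Qed.

Definition fg_submodule V (S : V -> Prop) : Prop := exists e, forall x, S x <-> lspan e x.

Definition image_sub V W (f : V -> W) (S : V -> Prop) (y : W) : Prop :=
  exists2 x, S x & f x = y.

Lemma image_submod V W (f : {linear V -> W}) S :
  is_submodule S -> is_submodule (image_sub f S).
Proof.
move=> [h0 h]; split; first by exists 0; rewrite ?linear0.
by move=> a _ _ [x Sx <-] [y Sy <-]; exists (a *: x + y); rewrite ?linearP //; apply: h.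
Qed.

Lemma lspan_image_lift V W (f : {linear V -> W}) S (e : seq W) :
  is_submodule S -> (forall y, y \in e -> image_sub f S y) ->
  exists e' : seq V, (forall x, x \in e' -> S x) /\
     forall y, lspan e y -> exists2 x, lspan e' x & f x = y.
Proof.
move=> hS; elim: e => [_|w e IH he].
  by exists [::]; split=> // y /= ->; exists 0; rewrite ?linear0.
have [|e' [he' se']] := IH; first by move=> y ye; apply: he; rewrite inE ye orbT.
have [|v Sv fv] := he w; first by rewrite mem_head.
exists (v :: e'); split=> [x|y /= [c [z [/se'[x sx <-] ->]]]].
  by rewrite inE => /orP[/eqP ->|/he'].
exists (c *: v + x); last by rewrite linearP fv.
by exists c, x.
Qed.

(** Generators of the image, lifted, together with generators of the kernel. *)
Lemma fg_submodule_ext V W (f : {linear V -> W}) S : is_submodule S ->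
  fg_submodule (image_sub f S) -> fg_submodule (fun x => S x /\ f x = 0) -> fg_submodule S.
Proof.
move=> hS [e he] [d hd].
have [|e' [he' se']] := @lspan_image_lift _ _ f S e hS.
  by move=> y ye; apply/he; exact: lspan_mem.
exists (e' ++ d) => x; split=> [Sx|].
  have /se'[x' sx' fx'] : lspan e (f x) by apply/he; exists x.
  rewrite -(subrK x' x) addrC; apply: submodD; first exact: lspan_submod.
    by apply: lspan_subset sx' => v ve; rewrite mem_cat ve.
  have : lspan d (x - x').
    apply/hd; split; last by rewrite linearB fx' subrr.
    by apply: submodB => //; apply: lspan_min sx'.
  by apply: lspan_subset => v ve; rewrite mem_cat ve orbT.
apply: lspan_min => // v; rewrite mem_cat => /orP[/he'//|vd].
by have /hd[] := lspan_mem vd.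
Qed.

Definition noetherian := forall I : R^o -> Prop, is_submodule I -> fg_submodule I.

Definition dcc V : Prop :=
  forall I : nat -> V -> Prop, (forall n, is_submodule (I n)) ->
    (forall n x, I n.+1 x -> I n x) ->
    exists N, forall n x, (N <= n)%N -> (I n x <-> I N x).

Lemma submodI V (S S' : V -> Prop) : is_submodule S -> is_submodule S' ->
  is_submodule (fun x => S x /\ S' x).
Proof.
move=> [h0 h] [h0' h']; split=> // a x y [Sx Sx'] [Sy Sy'].
by split; [apply: h|apply: h'].
Qed.

(** The leading coefficients of the elements of [S] with respect to [v], modulo
    the span of [e]: the ideal by which the inductions below reduce a statement
    on [v :: e] to one on [e]. *)
Definition coef_ideal V (v : V) (e : seq V) (S : V -> Prop) (c : R^o) : Prop :=
  exists2 y, lspan e y & S ((c : R) *: v + y).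

Lemma coef_ideal_submod V (v : V) e S :
  is_submodule S -> is_submodule (coef_ideal v e S).
Proof.
move=> hS; split.
  by exists 0; [case: (lspan_submod e)|rewrite scale0r addr0; case: hS].
move=> a c d [y sy Sy] [z sz Sz]; exists (a *: y + z).
  by case: (lspan_submod e) => _; apply.
have -> : (a *: c + d : R^o) *: v + (a *: y + z) =
         a *: ((c : R) *: v + y) + ((d : R) *: v + z).
  by rewrite scalerDl scalerDr scalerA addrACA.
by case: hS => _; apply.
Qed.

Lemma fg_submodule_span V (e : seq V) (S : V -> Prop) : noetherian ->
  is_submodule S -> (forall x, S x -> lspan e x) -> fg_submodule S.
Proof.
move=> hR; elim: e S => [|v e IH] S hS Se.
  by exists [::] => x; split=> [/Se //|/= ->]; case: hS.
(* d generates the leading coefficients and y completes each of them to an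
   element of S *)
have [d hd] := hR _ (coef_ideal_submod v e hS).
have [y hy] : exists y : R^o -> V, forall c : R^o, c \in d ->
    lspan e (y c) /\ S ((c : R) *: v + y c).
  apply: (@ex_choice _ _ (fun (c : R^o) y => c \in d ->
    lspan e y /\ S ((c : R) *: v + y))) => c.
  have [cd|_] := boolP (c \in d); last by exists 0.
  by have /hd[z sz Sz] := lspan_mem cd; exists z.
have [e' he'] : fg_submodule (fun x => S x /\ lspan e x).
  apply: IH; [by apply: submodI => //; exact: lspan_submod|by move=> x []].
pose g := [seq (c : R) *: v + y c | c : R^o <- d].
have gS x : x \in g -> S x by move=> /mapP[c cd ->]; have [] := hy c cd.
have sg c : lspan d c -> exists2 z, lspan g ((c : R) *: v + z) & lspan e z.
  rewrite /g; elim: d {hd gS g} hy c => [_ c /= ->|a d IHd hy c /= [b [c' [sc' ->]]]].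
    by exists 0; rewrite ?scale0r ?addr0 //; case: (lspan_submod e).
  have [|z sz ez] := IHd _ c' sc'; first by move=> q qd; apply: hy; rewrite inE qd orbT.
  have [|ya Sya] := hy a; first by rewrite mem_head.
  exists (b *: y a + z); last by case: (lspan_submod e) => _; apply.
  exists b, (c' *: v + z); split=> //.
  by rewrite scalerDl scalerDr scalerA !addrA; congr (_ + _); rewrite addrAC.
exists (g ++ e') => x; split=> [Sx|].
  have /= [c [z [sz xE]]] := Se _ Sx.
  have [|w gw ew] := sg c; first by apply/hd; exists z; rewrite // -xE.
  rewrite -(subrK ((c : R) *: v + w) x) addrC.
  apply: submodD; first exact: lspan_submod.
    by apply: lspan_subset gw => q qg; rewrite mem_cat qg.
  have : lspan e' (x - ((c : R) *: v + w)).
    apply/he'; split; first by apply: submodB => //; apply: lspan_min gw.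
    by rewrite xE opprD addrACA subrr add0r; apply: submodB => //; exact: lspan_submod.
  by apply: lspan_subset => q qg; rewrite mem_cat qg orbT.
apply: lspan_min => // w; rewrite mem_cat => /orP[/gS//|we].
by have /he'[] := lspan_mem we.
Qed.

(** A descending chain is stationary once both its leading coefficients and its
    intersections with the span of the remaining generators are. *)
Lemma dcc_span V (e : seq V) (I : nat -> V -> Prop) : dcc R^o ->
  (forall n, is_submodule (I n)) -> (forall n x, I n.+1 x -> I n x) ->
  (forall n x, I n x -> lspan e x) ->
  exists N, forall n x, (N <= n)%N -> (I n x <-> I N x).
Proof.
move=> hR; elim: e I => [|v e IH] I hI dI Ie.
  by exists 0%N => n x _; split=> /Ie /= ->; case: (hI 0%N); case: (hI n).
have dI' n m x : (m <= n)%N -> I n x -> I m x.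
  elim: n => [|n IHn]; first by rewrite leqn0 => /eqP ->.
  by rewrite leq_eqVlt ltnS => /orP[/eqP ->|/IHn h /dI /h].
have [||N hN] := hR (fun n => coef_ideal v e (I n)).
- by move=> n; exact: coef_ideal_submod.
- by move=> n c [y sy Iy]; exists y => //; apply: dI.
have [|||M hM] := IH (fun n x => I n x /\ lspan e x).
- by move=> n; apply: submodI => //; exact: lspan_submod.
- by move=> n x [/dI].
- by move=> n x [].
exists (maxn N M) => n x; rewrite geq_max => /andP[Nn Mn].
split; first by apply: dI'; rewrite geq_max Nn.
move=> Ix; have /= [c [y [sy xE]]] := Ie _ _ Ix.
have /(hN n c Nn)[z sz Iz] : coef_ideal v e (I N) c.
  by exists y => //; rewrite -xE; apply: dI' Ix; exact: leq_maxl.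
rewrite -(subrK ((c : R) *: v + z) x); apply: submodD => //.
have /(hM n _ Mn)[//] : I M (x - ((c : R) *: v + z)) /\ lspan e (x - ((c : R) *: v + z)).
split; last by rewrite xE opprD addrACA subrr add0r; apply: submodB => //; exact: lspan_submod.
by apply: submodB => //; [apply: dI' Ix; exact: leq_maxr|apply: dI' Iz].
Qed.

(** By dependent choice, a set of submodules without minimal element would
    contain an infinite strictly descending chain. *)
Lemma dcc_min V (P : (V -> Prop) -> Prop) (S0 : V -> Prop) : dcc V ->
  is_submodule S0 -> P S0 ->
  exists S, [/\ is_submodule S, P S &
    forall S', is_submodule S' -> P S' -> (forall x, S' x -> S x) ->
      forall x, S x -> S' x].
Proof.
move=> hV hS0 PS0; apply: contrapT => noS.
pose Q := {S : V -> Prop | is_submodule S /\ P S}.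
have [f hf] : exists f : Q -> Q, forall S, (forall x, sval (f S) x -> sval S x) /\
    ~ (forall x, sval S x -> sval (f S) x).
  apply: (@ex_choice Q Q (fun S S' => (forall x, sval S' x -> sval S x) /\
    ~ (forall x, sval S x -> sval S' x))) => -[S [hS PS]].
  apply: contrapT => h; apply: noS; exists S; split=> // S' hS' PS' S'S.
  apply: contrapT => nS; apply: h; by exists (exist _ S' (conj hS' PS')).
pose I n := iter n f (exist _ S0 (conj hS0 PS0)).
have [||N hN] := hV (fun n => sval (I n)).
- by move=> n; case: (svalP (I n)).
- by move=> n x; case: (hf (I n)) => h _; apply: h.
by case: (hf (I N)) => _; apply=> x Sx; apply/(hN N.+1).
Qed.

End Span.

Section ArtinianNoetherian.
Variables (k : comNzRingType) (hk : dcc k^o).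

Let mulr_lin (a : k^o) : {linear k^o -> k^o}.
Proof.
apply: (@mklin _ _ _ (fun x : k^o => (a : k) * (x : k) : k^o)) => c x y.
by rewrite mulrDr; congr (_ + _); exact: mulrCA.
Defined.

(** A counterexample would contain a minimal non-finitely generated ideal [I],
    which every scalar either kills or maps onto itself; so [I] would be an
    infinite-dimensional vector space over a field, and an infinite independent
    sequence in it would produce an infinite descending chain. *)
Lemma artinian_noetherian : noetherian k.
Proof.
move=> I0 hI0; apply: contrapT => nI0.
have [I [hI nI minI]] := dcc_min (P := fun S => ~ fg_submodule S) hk hI0 nI0.
have fgI J : is_submodule J -> (forall x, J x -> I x) ->
    fg_submodule J \/ forall x, I x -> J x.
  by move=> hJ JI; have [|nJ] := EM (fg_submodule J); [left|right; apply: minI].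
(* I / ann_I(a) is isomorphic to a I, and I would be finitely generated if both
   ann_I(a) and a I were proper *)
have dich (a : k) : (forall x : k, I x -> a * x = 0) \/
    (forall x : k, I x -> exists2 y : k, I y & a * y = x).
  have [||fi|] := fgI (image_sub (mulr_lin a) I).
  - exact: image_submod.
  - by move=> _ [x Ix <-]; rewrite /= -[_ * _]/(a *: (x : k^o)); apply: submodZ.
  - have [||fk|h] := fgI (fun x => I x /\ mulr_lin a x = 0).
    + split; first by split; [case: hI|rewrite linear0].
      move=> c x y [Ix x0] [Iy y0]; split; first by case: hI => _; apply.
      by rewrite linearP x0 y0 scaler0 addr0.
    + by move=> x [].
    + by case: nI; apply: fg_submodule_ext fi fk.
    by left=> x /h[].
  by move=> h; right=> x /h.
(* the ideals (c ^+ n) are stationary: c ^+ N = c ^+ N.+1 * d, so 1 - c * d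
   kills c ^+ N I, which is I *)
have cancelI (c : k) : (exists2 x : k, I x & c * x <> 0) ->
    exists d : k, forall v : k, I v -> d * (c * v) = v.
  move=> [x0 Ix0 cx0].
  have onto (x : k) : I x -> exists2 y : k, I y & c * y = x.
    by case: (dich c) x => // /(_ _ Ix0).
  have onton n (x : k) : I x -> exists2 y : k, I y & c ^+ n * y = x.
    elim: n x => [|n IHn] x Ix; first by exists x; rewrite ?expr0 ?mul1r.
    have [y Iy yx] := onto _ Ix; have [z Iz zy] := IHn _ Iy.
    by exists z => //; rewrite exprS -mulrA zy.
  have [||N hN] := hk (I := fun n x => exists d : k, x = c ^+ n * d).
  - move=> n; split; first by exists 0; rewrite mulr0.
    move=> a _ _ [d ->] [d' ->]; exists (a * d + d').
    by rewrite mulrDr mulrCA.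
  - by move=> n _ [d ->]; exists (c * d); rewrite mulrA -exprSr.
  have [_ /(_ (ex_intro _ 1 (esym (mulr1 _))))[d dE]] := hN N.+1 (c ^+ N) (leqnSn N).
  exists d => v Iv; have [y Iy <-] := onton N _ Iv.
  by rewrite !mulrA -[d * c * _]mulrA -exprS [d * _]mulrC -dE.
have [g hg] : exists g : seq k^o -> k^o, forall e, (forall v, v \in e -> I v) ->
    I (g e) /\ ~ lspan e (g e).
  apply: (@ex_choice _ _ (fun (e : seq k^o) x => (forall v, v \in e -> I v) ->
    I x /\ ~ lspan e x)) => e.
  have [he|] := EM (forall v, v \in e -> I v); last by exists 0.
  apply: contrapT => h; apply: nI; exists e => x; split; last exact: lspan_min.
  by move=> Ix; apply: contrapT => nx; apply: h; exists x.
(* v n lies in I but not in the span of L n, the list of the previous ones *)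
pose L := fix L n := if n is m.+1 then g (L m) :: L m else [::].
pose v n := g (L n).
have LI n x : x \in L n -> I x.
  elim: n x => //= n IHn x; rewrite inE => /orP[/eqP->|/IHn//].
  by have [] := hg (L n) IHn.
have vI n : I (v n) by have [] := hg (L n) (LI n).
have vL n m : (n < m)%N -> v n \in L m.
  elim: m => // m IHm; rewrite ltnS leq_eqVlt => /orP[/eqP->|/IHm h] /=; rewrite inE ?eqxx //.
  by rewrite h orbT.
have nv n : ~ lspan (L n) (v n) by have [] := hg (L n) (LI n).
(* the span of the v i with n <= i *)
pose W n x := exists m, lspan [seq v i | i <- iota n m] x.
have [||N hN] := hk (I := W).
- move=> n; split; first by exists 0%N.
  move=> a x y [m sx] [m' sy]; exists (maxn m m').
  have sub p q : (p <= q)%N ->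
      {subset [seq v i | i <- iota n p] <= [seq v i | i <- iota n q]}.
    move=> pq _ /mapP[i ip ->]; apply: map_f; move: ip; rewrite !mem_iota.
    by move=> /andP[-> /=] /leq_trans; apply; rewrite leq_add2l.
  by case: (lspan_submod [seq v i | i <- iota n (maxn m m')]) => _; apply;
    [apply: lspan_subset sx|apply: lspan_subset sy]; apply: sub; rewrite ?leq_maxl ?leq_maxr.
- move=> n x [m sx]; exists m.+1; apply: lspan_subset sx => y yi.
  by rewrite /= inE yi orbT.
have [m] : W N.+1 (v N).
  by apply/hN => //; exists 1%N; apply: lspan_mem; rewrite mem_head.
(* v N would be a combination of later terms; the last one with a coefficient
   that does not kill I would then lie in the span of its predecessors *)
elim: m => [/= v0|m IHm].
  by apply: (nv N); rewrite v0; case: (lspan_submod (L N)).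
rewrite -(addn1 m) iotaD map_cat /= => h.
have [y [c [sy vE]]] : exists y (c : k),
    lspan [seq v i | i <- iota N.+1 m] y /\ v N = y + c * v (N.+1 + m)%N.
  move: h; elim: [seq v i | i <- iota N.+1 m] (v N) => /= [x [c [y [-> ->]]]|w e IHe x].
    by exists 0, c; rewrite add0r addr0.
  move=> [c [y [/IHe[z [d [sz ->]]] ->]]]; exists (c *: w + z), d.
  by split; [exists c, z|rewrite addrA].
have [c0|] := EM (forall x : k, I x -> c * x = 0).
  by apply: IHm; rewrite vE c0 ?addr0.
move=> /existsNP[x /not_implyP[Ix cx]].
have [|d hd] := cancelI c; first by exists x.
apply: (nv (N.+1 + m)%N); rewrite -(hd _ (vI _)).
apply: submodZ; first exact: lspan_submod.
have -> : c * v (N.+1 + m)%N = v N - y by rewrite vE addrC addKr.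
apply: submodB; first exact: lspan_submod.
  by apply: lspan_mem; apply: vL; rewrite addSn ltnS leq_addr.
apply: lspan_subset sy => _ /mapP[i ii ->]; apply: vL.
by move: ii; rewrite mem_iota => /andP[].
Qed.

End ArtinianNoetherian.

(** * Finitely generated modules over an Artin algebra *)

Section FiniteLength.
Variables (k : comNzRingType) (A : algType k).

(** Restriction of scalars from [A] to [k]. *)
Definition resk (M : lmodType A) : Type := M.
HB.instance Definition _ (M : lmodType A) := GRing.Zmodule.on (resk M).

Section Resk.
Variable M : lmodType A.
Definition kscale (c : k) (x : resk M) : resk M := c%:A *: (x : M).

Lemma kscaleA a b x : kscale a (kscale b x) = kscale (a * b) x.
Proof. by rewrite /kscale scalerA -scalerAl mul1r scalerA. Qed.
Lemma kscale1 : left_id 1 kscale.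
Proof. by move=> x; rewrite /kscale !scale1r. Qed.
Lemma kscaleDr : right_distributive kscale +%R.
Proof. by move=> a x y; exact: scalerDr. Qed.
Lemma kscaleDl x : {morph kscale^~ x : a b / a + b}.
Proof. by move=> a b; rewrite /kscale scalerDl; exact: (@scalerDl A M). Qed.

HB.instance Definition _ := GRing.Zmodule_isLmodule.Build k (resk M)
  kscaleA kscale1 kscaleDr kscaleDl.

Lemma reskE c (x : M) : c *: (x : resk M) = c%:A *: x.
Proof. by []. Qed.

Lemma is_submodule_resk (S : M -> Prop) :
  is_submodule S -> is_submodule (S : resk M -> Prop).
Proof. by move=> [h0 h]; split=> // c x y; exact: h. Qed.

End Resk.

Lemma in_alg_comm (c : k) (a : A) : c%:A * a = a * c%:A.
Proof. by rewrite -scalerAl mul1r -scalerAr mulr1. Qed.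

Hypothesis hA : artin_algebra A.

(** The products of the generators of [A] over [k] and those of [M] over [A]
    generate [M] over [k]. *)
Lemma fin_gen_resk (M : lmodType A) : fin_gen M -> fin_gen (resk M).
Proof.
move=> /fin_gen_span[e he]; have [_ /fin_gen_span[d hd]] := hA.
pose L : seq (resk M) := [seq (a : A) *: (x : M) | a <- d, x <- e].
apply/fin_gen_span; exists L => y.
have SL := lspan_submod L.
have mulL (x : M) : x \in e -> forall a : A, lspan L (a *: x : M).
  move=> xe a; apply: (@lspan_min k A (fun a => lspan L (a *: x : M)) d) => //.
    split; first by rewrite scale0r; case: SL.
    move=> c b b' Lb Lb'; rewrite scalerDl -mulr_algl -scalerA.
    exact (submodD SL (submodZ c SL Lb) Lb').
  by move=> b bd; apply: lspan_mem; apply: allpairs_f.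
have scL (a : A) (x : resk M) : lspan L x -> lspan L (a *: (x : M) : M).
  apply: (@lspan_min k (resk M) (fun x => lspan L (a *: (x : M) : M)) L).
    split; first by rewrite scaler0; case: SL.
    move=> c z z' Lz Lz'; rewrite scalerDr reskE scalerA -in_alg_comm -scalerA.
    exact (submodD SL (submodZ c SL Lz) Lz').
  by move=> _ /allpairsP[[b z] /= [_ ze ->]]; rewrite scalerA; exact: mulL.
apply: (@lspan_min A M (fun x => @lspan k (resk M) L x) e _ _ y (he y)) => [|x xe].
  split; first by case: SL.
  by move=> a x z Lx Lz; exact (submodD SL (scL a x Lx) Lz).
by have := mulL x xe 1; rewrite scale1r.
Qed.

Lemma fin_gen_noetherian (M : lmodType A) (S : M -> Prop) :
  fin_gen M -> is_submodule S -> fg_submodule S.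
Proof.
move=> /fin_gen_resk/fin_gen_span[e he] hS.
have [art _] := hA.
have [d hd] := fg_submodule_span (artinian_noetherian art)
  (is_submodule_resk hS) (fun x _ => he x).
exists d => x; split=> [/hd sx|].
  apply: (@lspan_min k (resk M) (fun x => @lspan A M d x) d _ _ x sx)
    => [|y yd]; last exact (@lspan_mem A M d y yd).
  have SA := @lspan_submod A M d.
  by split; [case: SA|move=> c y z hy hz; exact (submodD SA (submodZ c%:A SA hy) hz)].
apply: (@lspan_min A M S d hS) => y yd; apply/hd; exact (@lspan_mem k (resk M) d y yd).
Qed.

Lemma fin_gen_dcc (M : lmodType A) : fin_gen M -> dcc M.
Proof.
move=> /fin_gen_resk/fin_gen_span[e he] I hI dI; have [art _] := hA.
by apply: (@dcc_span k (resk M) e I art) => // n; exact: is_submodule_resk.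
Qed.

End FiniteLength.

(** * Linear maps between sums *)

Section LinearMaps.
Variable R : nzRingType.
Implicit Types M N U V W T Z : lmodType R.

Lemma ex_inverse U V (f : {linear U -> V}) : bijective f ->
  exists g : {linear V -> U}, cancel f g /\ cancel g f.
Proof.
move=> [g fg gf]; have gL : linear g.
  by move=> a x y; apply: (can_inj fg); rewrite linearP !gf.
by exists (mklin gL).
Qed.

Lemma inj_surj_bij (T U : Type) (f : T -> U) : injective f -> surjective f -> bijective f.
Proof.
move=> fI /ex_choice[g gf]; exists g => // x.
by apply: fI; rewrite gf.
Qed.

Lemma linear_inj U V (f : {linear U -> V}) :
  (forall x, f x = 0 -> x = 0) -> injective f.
Proof.
move=> h x y fxy; apply/eqP; rewrite -subr_eq0; apply/eqP; apply: h.
by rewrite linearB fxy subrr.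
Qed.

Lemma copairL U V W (f : {linear U -> W}) (g : {linear V -> W}) :
  linear (fun x : U * V => f x.1 + g x.2).
Proof. by move=> a x y /=; rewrite !linearP scalerDr addrACA. Qed.
Definition copair U V W f g := mklin (@copairL U V W f g).

Lemma pairingL U V W (f : {linear W -> U}) (g : {linear W -> V}) :
  linear (fun x : W => (f x, g x)).
Proof. by move=> a x y /=; rewrite !linearP. Qed.
Definition pairing U V W f g := mklin (@pairingL U V W f g).

Lemma lfstL U V : linear (fun x : U * V => x.1). Proof. by []. Qed.
Definition lfst U V := mklin (@lfstL U V).
Lemma lsndL U V : linear (fun x : U * V => x.2). Proof. by []. Qed.
Definition lsnd U V := mklin (@lsndL U V).
Definition lin0 U V : {linear U -> V} := \0.
Definition lcomp U V W (g : {linear V -> W}) (f : {linear U -> V}) : {linear U -> W} := g \o f.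
Definition linid U : {linear U -> U} := idfun.

Lemma sum_mapL n M N (b : 'I_n -> {linear M -> N}) :
  linear (fun y : copies n M => \sum_i b i (y i)).
Proof.
move=> a x y; rewrite scaler_sumr -big_split /=; apply: eq_bigr => i _.
by rewrite !ffunE linearP.
Qed.
Definition sum_map n M N b := mklin (@sum_mapL n M N b).

Lemma tuple_mapL n M N (a : 'I_n -> {linear N -> M}) :
  linear (fun x => [ffun i => a i x] : copies n M).
Proof. by move=> c x y; apply/ffunP=> i; rewrite !ffunE linearP. Qed.
Definition tuple_map n M N a := mklin (@tuple_mapL n M N a).

Lemma copies_projL n M (i : 'I_n) : linear (fun y : copies n M => y i).
Proof. by move=> a x y; rewrite !ffunE. Qed.
Definition copies_proj n M i := mklin (@copies_projL n M i).

Lemma copies_injL n M (j : 'I_n) :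
  linear (fun x => [ffun i => if i == j then x else 0] : copies n M).
Proof.
move=> a x y; apply/ffunP=> i; rewrite !ffunE; case: eqP => // _.
by rewrite scaler0 addr0.
Qed.
Definition copies_inj n M j := mklin (@copies_injL n M j).

Lemma copies_sum n M (y : copies n M) : y = \sum_i copies_inj M i (y i).
Proof.
apply/ffunP => j; rewrite sum_ffunE (bigD1 j) //= big1 ?addr0; first by rewrite ffunE eqxx.
by move=> i ij; rewrite ffunE eq_sym (negPf ij).
Qed.

Lemma ex_factor U V W (g : {linear U -> V}) (h : {linear U -> W}) :
  surjective g -> (forall x, g x = 0 -> h x = 0) ->
  exists h' : {linear V -> W}, forall x, h' (g x) = h x.
Proof.
move=> /ex_choice[s gs] gh.
have hE x : h (s (g x)) = h x.
  by apply/eqP; rewrite -subr_eq0 -linearB gh // linearB gs subrr.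
have L : linear (fun y => h (s y)).
  by move=> a x y; rewrite -[in LHS](gs x) -[in LHS](gs y) -linearP hE linearP.
by exists (mklin L).
Qed.

Lemma ex_cofactor U V W (f : {linear U -> V}) (h : {linear W -> V}) :
  injective f -> (forall x, exists u, f u = h x) ->
  exists h' : {linear W -> U}, forall x, f (h' x) = h x.
Proof.
move=> fI /ex_choice[s fs].
have L : linear s by move=> a x y; apply: fI; rewrite linearP !fs linearP.
by exists (mklin L).
Qed.

Lemma ker_submod U V (f : {linear U -> V}) : is_submodule (fun x => f x = 0).
Proof.
split; first by rewrite linear0.
by move=> a x y fx fy; rewrite linearP fx fy scaler0 addr0.
Qed.

Lemma im_submod U V (f : {linear U -> V}) : is_submodule (fun y => exists x, f x = y).
Proof.
split; first by exists 0; rewrite linear0.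
by move=> a _ _ [x <-] [y <-]; exists (a *: x + y); rewrite linearP.
Qed.

Lemma ex_kernel V W (g : {linear V -> W}) : exists U (f : {linear U -> V}),
  injective f /\ forall v, g v = 0 <-> exists u, f u = v.
Proof. exact: ex_submodule (ker_submod g). Qed.

Lemma ex_cokernel U V (f : {linear U -> V}) : exists W (g : {linear V -> W}),
  surjective g /\ forall v, g v = 0 <-> exists u, f u = v.
Proof. exact: ex_quotient (im_submod f). Qed.

Lemma short_exactK U V W (f : {linear U -> V}) (g : {linear V -> W}) :
  short_exact f g -> forall u, g (f u) = 0.
Proof. by move=> [_ h _] u; apply/h; exists u. Qed.

Lemma fin_gen_surj V W (g : {linear V -> W}) : surjective g -> fin_gen V -> fin_gen W.
Proof.
move=> gs [n [e he]]; exists n, (fun i => g (e i)) => y.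
have [x <-] := gs y; have [c ->] := he x; exists c.
by rewrite linear_sum; apply: eq_bigr => i _; rewrite linearZ.
Qed.

Lemma fin_gen_ext U V W (f : {linear U -> V}) (g : {linear V -> W}) :
  (forall v, g v = 0 -> exists u, f u = v) -> surjective g ->
  fin_gen U -> fin_gen W -> fin_gen V.
Proof.
move=> ex gs /fin_gen_span[d hd] /fin_gen_span[e he].
have [//||e' [_ se']] := @lspan_image_lift _ _ _ g (fun=> True) e.
  by move=> y _; have [x <-] := gs y; exists x.
apply/fin_gen_span; exists ([seq f x | x <- d] ++ e') => x.
have [y sy yx] := se' (g x) (he _).
rewrite -(subrK y x); apply: submodD; first exact: lspan_submod.
  have [|u <-] := ex (x - y); first by rewrite linearB yx subrr.
  have hS : is_submodule (fun u => lspan ([seq f x | x <- d] ++ e') (f u)).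
    have [h0 h] := lspan_submod ([seq f x | x <- d] ++ e').
    by split; [rewrite linear0|move=> a u' u'' hu hu'; rewrite linearP; apply: h].
  apply: (lspan_min hS _ (hd u)) => w wd.
  by apply: lspan_mem; rewrite mem_cat map_f.
by apply: lspan_subset sy => w we; rewrite mem_cat we orbT.
Qed.

Lemma fin_gen_prod U V : fin_gen U -> fin_gen V -> fin_gen (U * V)%type.
Proof.
apply: (@fin_gen_ext U (U * V)%type V (pairing (linid U) (lin0 U V)) (lsnd U V)).
  by move=> [u v] /= ->; exists u.
by move=> v; exists (0, v).
Qed.

Lemma fin_gen_copies n M : fin_gen M -> fin_gen (copies n M).
Proof.
move=> hM; elim: n => [|n IH].
  exists 0%N, (fun=> 0) => x; exists (fun=> 0); rewrite big_ord0.
  by apply/ffunP => -[].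
pose p : {linear (M * copies n M)%type -> copies n.+1 M} :=
  copair (copies_inj M ord0) (sum_map (fun i => copies_inj M (lift ord0 i))).
apply: (@fin_gen_surj _ _ p); last exact: fin_gen_prod.
move=> y; exists (y ord0, [ffun i => y (lift ord0 i)]).
rewrite /= [y in RHS]copies_sum big_ord_recl; congr (_ + _).
by apply: eq_bigr => i _; rewrite ffunE.
Qed.

(** * Summands of powers, and maps that lift *)

Definition retract N M := exists (i : {linear N -> M}) (p : {linear M -> N}), cancel i p.

Lemma retract_complement M N (i : {linear N -> M}) (p : {linear M -> N}) : cancel i p ->
  exists (N' : lmodType R) (j : {linear N' -> M}),
    (forall y, p y = 0 <-> exists u, j u = y) /\ bijective (copair i j).
Proof.
move=> ip; have [N' [j [jI jE]]] := ex_kernel p; exists N', j; split=> //.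
have pj u : p (j u) = 0 by apply/jE; exists u.
apply: inj_surj_bij => [|y].
  apply: linear_inj => -[x u] /= xu0.
  have x0 : x = 0 by have := congr1 p xu0; rewrite linearD linear0 ip pj addr0.
  move: xu0; rewrite x0 linear0 add0r => u0; congr (_, _).
  by apply: jI; rewrite u0 linear0.
have /jE[u uE] : p (y - i (p y)) = 0 by rewrite linearB ip subrr.
by exists (p y, u); rewrite /= uE addrC subrK.
Qed.

Lemma add_classP M N : add_class M N <-> exists n, retract N (copies n M).
Proof.
split=> [[n [N' [f /ex_inverse[g [fg gf]]]]]|[n [i [p ip]]]].
  exists n, (f \o pairing (linid N) (lin0 N N')), (lfst N N' \o g) => x.
  by rewrite /= fg.
by have [N' [j [_ ijb]]] := retract_complement ip; exists n, N', (copair i j).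
Qed.

(** The ideal of the maps that factor through a power of [T] ([thruP]).  Stated
    with sums, it is visibly closed under addition and composition, and [M] lies
    in add T when its identity belongs to it ([add_class_thru]). *)
Definition thru T M N (f : {linear M -> N}) : Prop :=
  exists s : seq ({linear M -> T} * {linear T -> N}),
    forall x, f x = \sum_(p <- s) p.2 (p.1 x).

Lemma thru_one T M N (a : {linear M -> T}) (b : {linear T -> N}) : thru T (b \o a).
Proof. by exists [:: (a, b)] => x; rewrite big_seq1. Qed.

Lemma thruD T M N (f g h : {linear M -> N}) : thru T f -> thru T g ->
  (forall x, h x = f x + g x) -> thru T h.
Proof.
by move=> [s hs] [t ht] hE; exists (s ++ t) => x; rewrite hE big_cat hs ht.
Qed.

Lemma thru0 T M N (f : {linear M -> N}) : (forall x, f x = 0) -> thru T f.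
Proof. by move=> f0; exists [::] => x; rewrite big_nil. Qed.

Lemma thru_sum T M N (I : Type) (r : seq I) (F : I -> {linear M -> N}) (h : {linear M -> N}) :
  (forall i, thru T (F i)) -> (forall x, h x = \sum_(i <- r) F i x) -> thru T h.
Proof.
move=> hF; elim: r h => [|i r IH] h hE; first by apply: thru0 => x; rewrite hE big_nil.
have L : linear (fun x => \sum_(i <- r) F i x).
  move=> a x y; rewrite scaler_sumr -big_split; apply: eq_bigr => j _.
  by rewrite linearP.
by apply: (thruD (hF i) (IH (mklin L) (fun=> erefl))) => x; rewrite hE big_cons.
Qed.

Lemma thru_comp T M N M' N' (f : {linear M -> N}) (u : {linear M' -> M})
  (v : {linear N -> N'}) (h : {linear M' -> N'}) :
  thru T f -> (forall x, h x = v (f (u x))) -> thru T h.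
Proof.
move=> [s hs] hE.
exists [seq (lcomp p.1 u, lcomp v p.2) | p : {linear M -> T} * {linear T -> N} <- s] => x.
by rewrite big_map hE hs linear_sum.
Qed.

Lemma thru_trans T T' M N (f : {linear M -> N}) : thru T' (linid T) -> thru T f -> thru T' f.
Proof.
move=> hT [s hs]; apply: (thru_sum (r := s) (F := fun p => p.2 \o p.1)) => // p.
exact: (thru_comp (u := p.1) (v := p.2) hT).
Qed.

Lemma thruP T M N (f : {linear M -> N}) : thru T f <->
  exists n (a : {linear M -> copies n T}) (b : {linear copies n T -> N}), forall x, f x = b (a x).
Proof.
split=> [[s hs]|[n [a [b fE]]]].
  exists (size s), (tuple_map (fun i => (tnth (in_tuple s) i).1)),
    (sum_map (fun i => (tnth (in_tuple s) i).2)) => x.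
  by rewrite hs big_tnth; apply: eq_bigr => i _; rewrite ffunE.
apply: (thru_sum (F := fun i => (b \o copies_inj T i) \o (copies_proj T i \o a))) => [i|x].
  exact: thru_one.
by rewrite fE [a x in LHS]copies_sum linear_sum.
Qed.

Lemma add_class_thru T M : add_class T M <-> thru T (linid M).
Proof.
rewrite add_classP thruP; split=> [[n [i [p ip]]]|[n [a [b abE]]]].
  by exists n, i, p => x; rewrite ip.
by exists n, a, b => x; rewrite -abE.
Qed.

Lemma add_trans T T' M : add_class T' T -> add_class T M -> add_class T' M.
Proof. by rewrite !add_class_thru; exact: thru_trans. Qed.

Lemma add_refl T : add_class T T.
Proof. by apply/add_class_thru; exact: (thru_one (linid T) (linid T)). Qed.

Lemma add_copies T n : add_class T (copies n T).
Proof. by apply/add_classP; exists n, (linid _), (linid _). Qed.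

Lemma add_retract T M N : retract N M -> add_class T M -> add_class T N.
Proof.
move=> [i [p ip]] /add_class_thru h; apply/add_class_thru.
by apply: (thru_comp (u := i) (v := p) h) => x; rewrite /= ip.
Qed.

Lemma add_prod T M N : add_class T M -> add_class T N -> add_class T (M * N)%type.
Proof.
move=> /add_class_thru hM /add_class_thru hN; apply/add_class_thru.
have h1 : thru T (pairing (linid M) (lin0 M N) \o lfst M N).
  exact: (thru_comp (u := lfst M N) (v := pairing (linid M) (lin0 M N)) hM).
have h2 : thru T (pairing (lin0 N M) (linid N) \o lsnd M N).
  exact: (thru_comp (u := lsnd M N) (v := pairing (lin0 N M) (linid N)) hN).
by apply: (thruD h1 h2) => -[x y] /=; rewrite -[RHS]/(x + 0, 0 + y) addr0 add0r.
Qed.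

Lemma add_prodl M N : add_class (M * N)%type M.
Proof.
by apply: add_retract (add_refl _); exists (pairing (linid M) (lin0 M N)), (lfst M N).
Qed.

Lemma add_prodr M N : add_class (M * N)%type N.
Proof.
by apply: add_retract (add_refl _); exists (pairing (lin0 N M) (linid N)), (lsnd M N).
Qed.

Lemma add_fin_gen T M : fin_gen T -> add_class T M -> fin_gen M.
Proof.
move=> hT /add_classP[n [i [p ip]]].
by apply: (@fin_gen_surj _ _ p) (fin_gen_copies n hT) => x; exists (i x).
Qed.

Definition lifts Z V W (g : {linear V -> W}) : Prop :=
  forall h : {linear Z -> W}, exists h' : {linear Z -> V}, forall z, g (h' z) = h z.

Lemma lifts_add T Z V W (g : {linear V -> W}) : add_class T Z -> lifts T g -> lifts Z g.
Proof.
move=> /add_class_thru[s hs] hT h.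
suff [h' h'E] : exists h' : {linear Z -> V},
    forall z, g (h' z) = \sum_(p <- s) h (p.2 (p.1 z)).
  by exists h' => z; rewrite h'E -linear_sum -hs.
elim: s {hs} => [|p s [h' h'E]]; first by exists (lin0 Z V) => z; rewrite big_nil linear0.
have [l lE] := hT (h \o p.2); exists ((l \o p.1) \+ h') => z.
by rewrite /= linearD h'E big_cons lE.
Qed.

Lemma lifts_prod Z Z' V W (g : {linear V -> W}) :
  lifts Z g -> lifts Z' g -> lifts (Z * Z')%type g.
Proof.
move=> hZ hZ' h; have [a aE] := hZ (lcomp h (pairing (linid Z) (lin0 Z Z'))).
have [b bE] := hZ' (lcomp h (pairing (lin0 Z' Z) (linid Z'))).
exists (copair a b) => -[z z'].
have zz : (z, z') = (z, 0) + (0, z') :> (Z * Z')%type.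
  by congr (_, _); rewrite ?addr0 ?add0r.
by rewrite /= linearD aE bE zz linearD.
Qed.

Lemma lifts_comp Z U V W (f : {linear U -> V}) (g : {linear V -> W}) :
  lifts Z f -> lifts Z g -> lifts Z (g \o f).
Proof.
move=> hf hg h; have [h1 h1E] := hg h; have [h2 h2E] := hf h1.
by exists h2 => z; rewrite /= h2E.
Qed.

Lemma lifts_of_comp Z U V W (f : {linear U -> V}) (g : {linear V -> W}) :
  lifts Z (g \o f) -> lifts Z g.
Proof. by move=> hgf h; have [h' h'E] := hgf h; exists (f \o h') => z; rewrite -h'E. Qed.

End LinearMaps.

Section HomCover.
Variables (k : comNzRingType) (A : algType k) (hA : artin_algebra A).

(** [Hom(X, Z)] embeds into [Z ^ m] by evaluation at [m] generators of [X], so it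
    is finitely generated over [k]; since [k] acts centrally, a map that is a
    [k]-combination of the generators factors through their sum. *)
Lemma ex_hom_cover (X Z : lmodType A) : fin_gen X -> fin_gen Z ->
  exists n (p : {linear copies n X -> Z}), lifts X p.
Proof.
move=> [m [e he]] hZ; have [art _] := hA.
have /(fin_gen_resk hA)/fin_gen_span[d0 hd0] := fin_gen_copies m hZ.
pose S (y : resk (copies m Z)) := 
  exists h : {linear X -> Z}, forall i, (y : copies m Z) i = h (e i).
have hS : is_submodule S.
  split; first by exists (lin0 X Z) => i; rewrite ffunE.
  move=> c y y' [h hE] [h' h'E].
  have L : linear (fun x => c%:A *: h x + h' x).
    move=> a u v; rewrite !linearP !scalerDr !scalerA in_alg_comm.
    by rewrite addrACA.
  by exists (mklin L) => i; rewrite !ffunE hE h'E.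
have [d hd] := fg_submodule_span (artinian_noetherian art) hS (fun x _ => hd0 x).
have [H hH] : exists H : 'I_(size d) -> {linear X -> Z},
    forall (j : 'I_(size d)) i, (d`_j : copies m Z) i = H j (e i).
  apply: (@ex_choice _ _ (fun (j : 'I_(size d)) (h : {linear X -> Z}) =>
    forall i, (d`_j : copies m Z) i = h (e i))) => j.
  by apply/hd; apply: lspan_mem; exact: mem_nth.
exists (size d), (sum_map H) => h.
have /hd/lspan_sum[c cE] : S ([ffun i => h (e i)] : copies m Z).
  by exists h => i; rewrite ffunE.
have L : linear (fun x => [ffun j => (c j)%:A *: x] : copies (size d) X).
  move=> a x y; apply/ffunP=> j; rewrite !ffunE scalerDr !scalerA.
  by rewrite in_alg_comm.
exists (mklin L) => x; have [b ->] := he x.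
rewrite !linear_sum; apply: eq_bigr => i _; rewrite !linearZ; congr (_ *: _).
have := congr1 (fun y : copies m Z => y i) cE; rewrite ffunE => ->.
rewrite /= sum_ffunE; apply: eq_bigr => j _.
by rewrite !ffunE linearZ hH.
Qed.

End HomCover.

(** * Fitting's lemma *)

Section KrullSchmidt.
Variable A : nzRingType.
Hypothesis noethA : forall (M : lmodType A) (S : M -> Prop),
  fin_gen M -> is_submodule S -> fg_submodule S.
Hypothesis dccA : forall M : lmodType A, fin_gen M -> dcc M.
Implicit Types M N T U V W : lmodType A.

Lemma iter_linear U (f : {linear U -> U}) n : linear (iter n f).
Proof. by move=> a x y; elim: n => //= n ->; rewrite linearP. Qed.
Definition lpow U (f : {linear U -> U}) n := mklin (iter_linear f n).

Lemma iter_f0 U (f : {linear U -> U}) n : iter n f 0 = 0.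
Proof. exact: (linear0 (lpow f n)). Qed.

Lemma iter_fB U (f : {linear U -> U}) n x y : iter n f (x - y) = iter n f x - iter n f y.
Proof. exact: (linearB (lpow f n)). Qed.

Lemma iter_ker U (f : {linear U -> U}) n m x : (n <= m)%N -> iter n f x = 0 -> iter m f x = 0.
Proof. by move=> nm x0; rewrite -(subnK nm) iterD x0 iter_f0. Qed.

(** The map [e] is the projection onto the image of [f ^ m] along its kernel, for
    an [m] from which the images and the kernels of the powers are
    stationary. *)
Lemma fitting U (f : {linear U -> U}) : fin_gen U ->
  exists m (e : {linear U -> U}),
    [/\ (0 < m)%N, forall x, exists y, e x = iter m f y,
       forall y, e (iter m f y) = iter m f y
     & forall x, e x = 0 <-> iter m f x = 0].
Proof.
move=> hU.
have [||N hN] := dccA hU (I := fun n y => exists x, lpow f n x = y).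
- by move=> n; exact: im_submod.
- by move=> n _ [x <-]; exists (f x); rewrite /= -iterSr.
(* the union of the kernels is finitely generated, hence it is one of them *)
have [|d hd] := @noethA U (fun x => exists n, iter n f x = 0) hU.
  split; first by exists 0%N.
  move=> a x y [n nx] [m my]; exists (maxn n m); rewrite iter_linear.
  by rewrite (iter_ker (leq_maxl n m) nx) (iter_ker (leq_maxr n m) my) scaler0 addr0.
have [k hM] : exists k, forall x, (exists n, iter n f x = 0) -> iter k f x = 0.
  suff [k hM] : exists k, forall x, lspan d x -> iter k f x = 0.
    by exists k => x /hd/hM.
  have dK x : x \in d -> exists n, iter n f x = 0 by move=> /lspan_mem/hd.
  elim: d dK {hd} => [_|v d IH dK].
    by exists 0%N => x ->.
  have [|k hM] := IH; first by move=> x xd; apply: dK; rewrite inE xd orbT.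
  have [|n nv] := dK v; first by rewrite mem_head.
  exists (maxn n k) => _ [c [y [/hM yM ->]]]; rewrite iter_linear.
  by rewrite (iter_ker (leq_maxl n k) nv) (iter_ker (leq_maxr n k) yM) scaler0 addr0.
pose m := (maxn N k).+1.
have Nm : (N <= m)%N by rewrite leqW ?leq_maxl.
have Mm : (k <= m)%N by rewrite leqW ?leq_maxr.
have m0 : (0 < m)%N by [].
clearbody m.
have kerm x : iter m f (iter m f x) = 0 -> iter m f x = 0.
  by rewrite -iterD => mx; apply: (iter_ker Mm); apply: hM; exists (m + m)%N.
have /ex_choice[s sE] : forall x, exists y, iter m f (iter m f y) = iter m f x.
  move=> x; have [|y yE] := (proj2 (hN (m + m)%N (iter m f x) (leq_trans Nm (leq_addr _ _)))).
    by exists (iter (m - N) f x); rewrite /= -iterD subnKC.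
  by exists y; rewrite -iterD.
have injm x y : iter m f (iter m f x) = iter m f (iter m f y) -> iter m f x = iter m f y.
  move=> xy; apply/eqP; rewrite -subr_eq0 -iter_fB; apply/eqP/kerm.
  by rewrite !iter_fB xy subrr.
have L : linear (fun x => iter m f (s x)).
  move=> a x y; rewrite -iter_linear; apply: injm.
  by rewrite sE !iter_linear !sE.
exists m, (mklin L); split=> // [x|y|x].
- by exists (s x).
- by apply: injm; rewrite sE.
split=> /= x0; first by rewrite -sE x0 iter_f0.
by apply: kerm; rewrite sE.
Qed.

Lemma surj_endo_bij U (f : {linear U -> U}) : fin_gen U -> surjective f -> bijective f.
Proof.
move=> hU fs; apply: inj_surj_bij => //.
have [m [e [m0 _ eE ek]]] := fitting f hU.
have itsurj n y : exists x, iter n f x = y.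
  elim: n y => [|n IH] y; first by exists y.
  by have [z <-] := fs y; have [x <-] := IH z; exists x.
have eid x : e x = x by have [y <-] := itsurj m x; rewrite eE.
apply: linear_inj => x fx0; rewrite -(eid x); apply/ek.
by apply: (@iter_ker _ _ 1).
Qed.

(** * Indecomposable modules have local endomorphism rings *)

Lemma zero_bij M (f : {linear M -> M}) : bijective f -> (forall x, f x = 0) -> zero_module M.
Proof. by move=> [g fg gf] f0 x; rewrite -[x]fg f0 -[RHS]fg f0. Qed.

Lemma indecomposable_retract M N (i : {linear N -> M}) (p : {linear M -> N}) :
  indecomposable M -> cancel i p -> zero_module N \/ cancel p i.
Proof.
move=> [_ ind] ip; have [N' [j [jE ijb]]] := retract_complement ip.
have [|N0|N'0] := ind N N'; [by exists (copair i j)|by left|right] => x.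
have /jE[u uE] : p (x - i (p x)) = 0 by rewrite linearB ip subrr.
by apply/eqP; rewrite eq_sym -subr_eq0 -uE (N'0 u) linear0.
Qed.

Lemma indecomposable_endo M (f : {linear M -> M}) : fin_gen M -> indecomposable M ->
  bijective f \/ exists m, forall x, iter m f x = 0.
Proof.
move=> hM ind; have [m [e [m0 eim eE eker]]] := fitting f hM.
have [N [inc [incI incE]]] := ex_submodule (im_submod e).
have [|r rE] := @ex_cofactor _ _ _ _ inc e incI.
  by move=> x; apply/incE; exists x.
have incr : cancel inc r.
  move=> u; apply: incI; rewrite rE; have /incE[x <-] : exists u', inc u' = inc u by exists u.
  by have [y ->] := eim x; rewrite eE.
have [N0|eid] := indecomposable_retract ind incr.
  by right; exists m => x; apply/eker; rewrite -rE (N0 (r x)) linear0.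
left; apply: surj_endo_bij => // x; have [y yE] := eim x.
by exists (iter m.-1 f y); rewrite -iterS prednK // -yE -rE eid.
Qed.

Lemma bij_comp_inv U V W (f : {linear U -> V}) (g : {linear V -> W}) :
  bijective g -> bijective (g \o f) -> bijective f.
Proof.
move=> [g' gg' g'g] [h hK Kh]; exists (h \o g) => x /=; first exact: hK.
by apply: (can_inj gg'); exact: Kh.
Qed.

(** Up to the inverse of [f + g] the sum is the identity.  By Fitting's lemma a
    summand that is not bijective is nilpotent; if both were, [g] would
    be nilpotent and injective, since [f] is the identity on its kernel. *)
Lemma indecomposable_local M (f g : {linear M -> M}) : fin_gen M -> indecomposable M ->
  bijective (fun x => f x + g x) -> bijective f \/ bijective g.
Proof.
move=> hM ind; have [nz _] := ind.
move=> /(@ex_inverse _ _ _ (f \+ g))[h [hK Kh]].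
have hb : bijective h by exists (f \+ g).
have hfg x : h (f x) + h (g x) = x by rewrite -linearD; exact: hK.
have [?|[m hm]] := indecomposable_endo (lcomp h f) hM ind.
  by left; exact: (bij_comp_inv hb).
have [?|[n hn]] := indecomposable_endo (lcomp h g) hM ind.
  by right; exact: (bij_comp_inv hb).
case: nz; suff inj x : h (g x) = 0 -> x = 0.
  elim: n hn => [hn x|n IH hn]; first exact: hn.
  by apply: IH => x; apply: inj; exact: hn.
move=> gx0; have fx : lcomp h f x = x by rewrite -[RHS]hfg gx0 addr0.
by rewrite -(hm x); elim: m {hm} => //= m <-.
Qed.

Lemma indecomposable_sum M (I : Type) (r : seq I) (G : I -> {linear M -> M})
    (h : {linear M -> M}) :
  fin_gen M -> indecomposable M -> bijective h -> (forall x, h x = \sum_(i <- r) G i x) ->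
  exists i, bijective (G i).
Proof.
move=> hM ind; elim: r h => [|i r IH] h hb hE.
  by case: ind => -[]; apply: zero_bij hb _ => x; rewrite hE big_nil.
have L : linear (fun x => \sum_(i <- r) G i x).
  move=> a x y; rewrite scaler_sumr -big_split; apply: eq_bigr => j _.
  by rewrite linearP.
have [|?|/IH] := @indecomposable_local M (G i) (mklin L) hM ind; [|by exists i|exact].
by apply: (eq_bij hb) => x; rewrite hE big_cons.
Qed.

Lemma retract_bij M N (a : {linear M -> N}) (b : {linear N -> M}) :
  bijective (b \o a) -> retract M N.
Proof.
move=> /(@ex_inverse _ _ _ (lcomp b a))[c [cK _]].
by exists a, (lcomp c b) => x; exact: cK.
Qed.

Lemma indecomposable_add T M : fin_gen M -> indecomposable M -> add_class T M -> retract M T.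
Proof.
move=> hM ind /add_class_thru[s sE].
have idb : bijective (linid M) by exists id.
have [p pb] := indecomposable_sum (G := fun p => lcomp p.2 p.1) hM ind idb sE.
exact: retract_bij pb.
Qed.

Lemma retract_indecomposable M N : indecomposable M -> indecomposable N ->
  retract M N -> isomorphic M N.
Proof.
move=> [nz _] ind [i [p ip]]; exists i; exists p => //.
by have [] := indecomposable_retract ind ip.
Qed.

Lemma isomorphic_sym M N : isomorphic M N -> isomorphic N M.
Proof. by move=> [f /ex_inverse[g [fg gf]]]; exists g, f. Qed.

Lemma isomorphic_trans M N T : isomorphic M N -> isomorphic N T -> isomorphic M T.
Proof. by move=> [f fb] [g gb]; exists (lcomp g f); exact: bij_comp. Qed.

Lemma isomorphic_retract M N : isomorphic M N -> retract M N.
Proof. by move=> [f /ex_inverse[g [fg gf]]]; exists f, g. Qed.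

(** * Uniqueness and existence of basic modules *)

Lemma direct_sum_proj n (N : 'I_n -> lmodType A) M : is_direct_sum N M ->
  exists (e : forall i, {linear N i -> M}) (p : forall i, {linear M -> N i}),
    [/\ forall x, x = \sum_i e i (p i x), forall i, cancel (e i) (p i)
       & forall i j y, i != j -> p i (e j y) = 0].
Proof.
move=> [e [sur uni]].
have [y yE] : exists y : M -> forall i, N i, forall x, x = \sum_i e i (y x i).
  exact: ex_choice sur.
have uniq z z' : \sum_i e i (z i) = \sum_i e i (z' i) -> forall i, z i = z' i.
  move=> zz' i; apply/eqP; rewrite -subr_eq0; apply/eqP; move: i.
  apply: uni; under eq_bigr do rewrite linearB.
  by rewrite sumrB zz' subrr.
have L i : linear (fun x => y x i).
  move=> a u v; move: i; apply: uniq; rewrite -yE.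
  under eq_bigr do rewrite linearP.
  by rewrite big_split -scaler_sumr -!yE.
have ye i z : forall j, y (e i z) j = dfwith (fun j => 0 : N j) z j.
  apply: uniq; rewrite -yE (bigD1 i) //= dfwith_in big1 ?addr0 // => j ji.
  by rewrite dfwith_out 1?eq_sym // linear0.
exists e, (fun i => mklin (L i)); split=> // [i z|i j z ij] /=.
  by rewrite ye dfwith_in.
by rewrite ye dfwith_out // eq_sym.
Qed.

(** Each indecomposable summand of [T] is a summand of a power of [T'], hence, by
    locality, isomorphic to one of the indecomposable summands of [T'], and
    conversely; as both modules are basic this matches the two families
    bijectively. *)
Lemma basic_add_isomorphic T T' : fin_gen T -> fin_gen T' -> basic T -> basic T' ->
  add_class T T' -> add_class T' T -> isomorphic T T'.
Proof.
move=> hT hT' [_ [n [N [/direct_sum_proj[e [p [epE pe pe0]]] Ni Nu]]]].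
move=> [_ [n' [N' [/direct_sum_proj[e' [p' [epE' pe' pe0']]] Ni' Nu']]]] TT' T'T.
have match_summand m (L : 'I_m -> lmodType A) U (d : forall i, {linear L i -> U})
    (q : forall i, {linear U -> L i}) V :
    (forall x, x = \sum_i d i (q i x)) -> (forall i, indecomposable (L i)) ->
    fin_gen V -> indecomposable V -> add_class U V -> exists i, isomorphic V (L i).
  move=> dq Li hV Vi UV; have [a [b ab]] := indecomposable_add hV Vi UV.
  have idb : bijective (linid V) by exists id.
  have [i ib] : exists i, bijective (lcomp (lcomp b (d i)) (lcomp (q i) a)).
    apply: (indecomposable_sum (r := index_enum 'I_m) hV Vi idb) => x /=.
    by rewrite -[LHS]ab [a x in LHS]dq linear_sum.
  by exists i; apply: retract_indecomposable => //; exact: retract_bij ib.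
have rT i : retract (N i) T by exists (e i), (p i).
have rT' i : retract (N' i) T' by exists (e' i), (p' i).
have hN i : fin_gen (N i) := add_fin_gen hT (add_retract (rT i) (add_refl T)).
have hN' i : fin_gen (N' i) := add_fin_gen hT' (add_retract (rT' i) (add_refl T')).
have /ex_choice[s sE] : forall i, exists j, isomorphic (N i) (N' j).
  move=> i; apply: match_summand epE' Ni' (hN i) (Ni i) _.
  exact: add_trans T'T (add_retract (rT i) (add_refl T)).
have /ex_choice[t tE] : forall j, exists i, isomorphic (N' j) (N i).
  move=> j; apply: match_summand epE Ni (hN' j) (Ni' j) _.
  exact: add_trans TT' (add_retract (rT' j) (add_refl T')).
have stK : cancel s t.
  by move=> i; apply/esym/Nu; exact: isomorphic_trans (sE i) (tE _).
have tsK : cancel t s.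
  by move=> j; apply/esym/Nu'; exact: isomorphic_trans (tE j) (sE _).
have [phi phib] : exists phi : forall i, {linear N i -> N' (s i)}, forall i, bijective (phi i).
  by have [f fE] := fin_all_exists sE; exists f.
have L : linear (fun x => \sum_i e' (s i) (phi i (p i x))).
  move=> a x y; rewrite scaler_sumr -big_split; apply: eq_bigr => i _.
  by rewrite !linearP.
exists (mklin L); apply: inj_surj_bij => [|y].
  apply: linear_inj => x /= x0; rewrite [x]epE big1 // => i _.
  have := congr1 (p' (s i)) x0; rewrite linear0 linear_sum (bigD1 i) //= pe'.
  rewrite big1 ?addr0 => [|j ji]; last first.
    by rewrite pe0' // (inj_eq (can_inj stK)) eq_sym.
  rewrite -[0](linear0 (phi i)) => /(bij_inj (phib i)) ->.
  exact: linear0.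
have /fin_all_exists[z zE] : forall i, exists z, phi i z = p' (s i) y.
  by move=> i; have [g _ gK] := phib i; exists (g (p' (s i) y)).
exists (\sum_i e i (z i)); rewrite /= [RHS]epE' (reindex s) /=; last first.
  by exists t => i _; rewrite ?stK ?tsK.
apply: eq_bigr => i _; rewrite -zE; congr (e' _ (phi _ _)).
rewrite linear_sum (bigD1 i) //= pe big1 ?addr0 // => j ji.
by rewrite pe0 // eq_sym.
Qed.

(** A decomposition of [M], of which only what determines add M is recorded. *)
Definition indecomposable_pieces M : Prop :=
  exists (I : finType) (N : I -> lmodType A)
    (a : forall i, {linear M -> N i}) (b : forall i, {linear N i -> M}),
    [/\ forall i, indecomposable (N i), forall i, retract (N i) M
       & forall x, x = \sum_i b i (a i x)].

Lemma pieces_prod M M' U : indecomposable_pieces M -> indecomposable_pieces M' ->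
  isomorphic (M * M')%type U -> indecomposable_pieces U.
Proof.
move=> [I [N [a [b [Ni Nr ab]]]]] [I' [N' [a' [b' [Ni' Nr' ab']]]]].
move=> [f /ex_inverse[g [fg gf]]].
pose L (k : I + I') := match k with inl i => N i | inr i => N' i end.
exists (I + I')%type, L.
exists (fun k => match k return {linear U -> L k} with
  | inl i => lcomp (a i) (lcomp (lfst M M') g)
  | inr i => lcomp (a' i) (lcomp (lsnd M M') g) end).
exists (fun k => match k return {linear L k -> U} with
  | inl i => lcomp f (lcomp (pairing (linid M) (lin0 M M')) (b i))
  | inr i => lcomp f (lcomp (pairing (lin0 M' M) (linid M')) (b' i)) end).
split=> [[]// |[i|i]|x].
- have [d [q dq]] := Nr i.
  exists (lcomp f (lcomp (pairing (linid M) (lin0 M M')) d)),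
    (lcomp q (lcomp (lfst M M') g)).
  by move=> y; rewrite /= fg /= dq.
- have [d [q dq]] := Nr' i.
  exists (lcomp f (lcomp (pairing (lin0 M' M) (linid M')) d)),
    (lcomp q (lcomp (lsnd M M') g)).
  by move=> y; rewrite /= fg /= dq.
rewrite big_sumType -[LHS]gf.
have -> : g x = \sum_i pairing (linid M) (lin0 M M') (b i (a i (g x).1)) +
    \sum_i pairing (lin0 M' M) (linid M') (b' i (a' i (g x).2)).
  rewrite -2!linear_sum -ab -ab' /= [LHS]surjective_pairing.
  by congr (_, _); rewrite ?addr0 ?add0r.
by rewrite linearD !linear_sum.
Qed.

(** A minimal submodule without such a decomposition would be a sum of two
    proper ones. *)
Lemma ex_pieces M : fin_gen M -> indecomposable_pieces M.
Proof.
move=> hM; apply: contrapT => nM.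
pose D (S : M -> Prop) := exists (U : lmodType A) (i : {linear U -> M}),
  [/\ injective i, forall x, S x <-> exists u, i u = x & ~ indecomposable_pieces U].
have [||S [_ [U [i [iI iE nU]]] minS]] := dcc_min (P := D) (S0 := fun=> True) (dccA hM).
- by [].
- by exists M, (linid M); split=> // x; split=> // _; exists x.
have nz : ~ zero_module U.
  move=> U0; apply: nU; exists void, (fun=> U), (fun=> linid U), (fun=> linid U).
  by split=> // x; rewrite big_pred0 ?U0 // => -[].
have nind : ~ indecomposable U.
  move=> Ui; apply: nU; exists unit, (fun=> U), (fun=> linid U), (fun=> linid U).
  by split=> // [_|x]; [exists (linid U), (linid U)|rewrite (big_pred1 tt) // => -[]].
apply: nind; split=> // N N' NN'; apply: contrapT => /not_orP[N0 N'0].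
have [f /ex_inverse[g [fg gf]]] := NN'.
have min_piece (L : lmodType A) (d : {linear L -> U}) :
    injective d -> ~ indecomposable_pieces L ->
    forall u, exists l, d l = u.
  move=> dI nL u.
  have [||||l /iI lu] := minS (fun x => exists l, lcomp i d l = x) _ _ _ (i u).
  - exact: im_submod.
  - by exists L, (lcomp i d); split=> // x y /iI/dI.
  - by move=> _ [l <-]; apply/iE; exists (d l).
  - by apply/iE; exists u.
  by exists l.
apply: nU; apply: (pieces_prod _ _ NN'); apply: contrapT => nL.
  apply: N'0 => y.
  have [|//|x] := min_piece N (lcomp f (pairing (linid N) (lin0 N N'))) _ _ (f (0, y)).
    by move=> x x' /(can_inj fg)[].
  by move=> /(can_inj fg)[_ <-].
apply: N0 => x.
have [|//|y] := min_piece N' (lcomp f (pairing (lin0 N' N) (linid N'))) _ _ (f (x, 0)).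
  by move=> y y' /(can_inj fg)[].
by move=> /(can_inj fg)[<-].
Qed.

Definition dprod (I : finType) (N : I -> lmodType A) : Type := forall i, N i.

Section DirectProduct.
Variables (I : finType) (N : I -> lmodType A).
HB.instance Definition _ := gen_eqMixin (dprod N).
HB.instance Definition _ := gen_choiceMixin (dprod N).

Let ext (f g : dprod N) : (forall i, f i = g i) -> f = g.
Proof. exact: functional_extensionality_dep. Qed.

Let add (f g : dprod N) : dprod N := fun i => f i + g i.
Let opp (f : dprod N) : dprod N := fun i => - f i.
Let zero : dprod N := fun i => 0.
Let scale (a : A) (f : dprod N) : dprod N := fun i => a *: f i.

Let addA : associative add.
Proof. by move=> f g h; apply: ext => i; exact: addrA. Qed.
Let addC : commutative add.
Proof. by move=> f g; apply: ext => i; exact: addrC. Qed.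
Let add0 : left_id zero add.
Proof. by move=> f; apply: ext => i; exact: add0r. Qed.
Let addN : left_inverse zero opp add.
Proof. by move=> f; apply: ext => i; exact: addNr. Qed.
HB.instance Definition _ := GRing.isZmodule.Build (dprod N) addA addC add0 addN.

Let scaleA a b f : scale a (scale b f) = scale (a * b) f.
Proof. by apply: ext => i; exact: scalerA. Qed.
Let scale1 : left_id 1 scale.
Proof. by move=> f; apply: ext => i; exact: scale1r. Qed.
Let scaleDr : right_distributive scale +%R.
Proof. by move=> a f g; apply: ext => i; exact: scalerDr. Qed.
Let scaleDl f : {morph scale^~ f : a b / a + b}.
Proof. by move=> a b; apply: ext => i; exact: scalerDl. Qed.
HB.instance Definition _ := GRing.Zmodule_isLmodule.Build A (dprod N)
  scaleA scale1 scaleDr scaleDl.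

Lemma dprod_sum (J : finType) (G : J -> dprod N) i : (\sum_j G j) i = \sum_j G j i.
Proof. by apply: (big_morph (fun f : dprod N => f i)). Qed.

Lemma dprod_injL i : linear (fun x : N i => dfwith (fun j => 0 : N j) x : dprod N).
Proof.
move=> a x y; apply: ext => j.
rewrite -[RHS]/(a *: dfwith (fun j => 0 : N j) x j + dfwith (fun j => 0 : N j) y j).
have [<-|ij] := eqVneq i j; first by rewrite !dfwith_in.
by rewrite !dfwith_out // scaler0 addr0.
Qed.
Definition dprod_inj i : {linear N i -> (dprod N : lmodType A)} := mklin (@dprod_injL i).

Lemma dprod_projL i : linear (fun x : dprod N => x i). Proof. by []. Qed.
Definition dprod_proj i : {linear (dprod N : lmodType A) -> N i} := mklin (@dprod_projL i).

Lemma dprod_injK i : cancel (dprod_inj i) (dprod_proj i).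
Proof. by move=> x; rewrite /= dfwith_in. Qed.

Lemma dprodE (y : forall i, N i) : \sum_i dprod_inj i (y i) = y :> dprod N.
Proof.
apply: ext => i; rewrite dprod_sum (bigD1 i) //= dfwith_in big1 ?addr0 // => j ji.
by rewrite dfwith_out.
Qed.

End DirectProduct.

Lemma dprod_direct_sum n (N : 'I_n -> lmodType A) : is_direct_sum N (dprod N : lmodType A).
Proof.
exists (dprod_inj N); split=> [x|y y0 i]; first by exists x; rewrite dprodE.
by rewrite -[y i]/((y : dprod N) i) -(dprodE y) y0.
Qed.

(** Keep one piece of [M] from each isomorphism class: here, the one of least
    rank. *)
Lemma ex_basic_part M : fin_gen M -> ~ zero_module M ->
  exists B : lmodType A, [/\ basic B, add_class M B & add_class B M].
Proof.
move=> hM nz; have [I [N [a [b [Ni Nr ab]]]]] := ex_pieces hM.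
pose iso i j := `[< isomorphic (N i) (N j) >].
pose R := [set i | [forall j, iso i j ==> (enum_rank i <= enum_rank j)%N]].
have rep i : exists2 j, j \in R & isomorphic (N i) (N j).
  have ii : iso i i by apply/asboolP; exists (linid (N i)), id.
  case: (arg_minnP (fun j => enum_rank j : nat) ii) => j /asboolP ij jmin.
  exists j => //; rewrite inE; apply/forallP => l; apply/implyP => /asboolP jl.
  by apply: jmin; apply/asboolP; exact: isomorphic_trans ij jl.
have Runiq i j : i \in R -> j \in R -> isomorphic (N i) (N j) -> i = j.
  rewrite !inE => /forallP iR /forallP jR ij; apply/enum_rank_inj/val_inj/eqP.
  rewrite eqn_leq (implyP (iR j)) ?(implyP (jR i)) //; apply/asboolP => //.
  exact: isomorphic_sym.
pose L (k : 'I_#|R|) := N (enum_val k).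
pose B : lmodType A := dprod L.
have MB : add_class B M.
  apply/add_class_thru.
  apply: (thru_sum (F := fun i => lcomp (b i) (a i)) (r := index_enum I)) => //.
  move=> i; have [j jR ij] := rep i.
  have /add_class_thru h : add_class B (N i).
    apply: add_retract (isomorphic_retract ij) _.
    rewrite -(enum_rankK_in jR jR).
    apply: add_retract (add_refl B).
    by exists (dprod_inj L _), (dprod_proj L _); exact: dprod_injK.
  exact: (thru_comp (u := a i) (v := b i) h).
exists B; split=> //.
- split; last first.
    exists #|R|, L; split; [exact: dprod_direct_sum|by move=> i; exact: Ni|].
    by move=> i j ij; apply: enum_val_inj; apply: Runiq ij; exact: enum_valP.
  move=> B0; apply: nz => x; have /add_class_thru[s sE] := MB.
  by rewrite -[LHS]/(linid M x) sE big1 // => p _; rewrite (B0 (p.1 x)) linear0.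
- apply/add_class_thru.
  apply: (thru_sum (F := fun k => lcomp (dprod_inj L k) (dprod_proj L k))
    (r := index_enum 'I_#|R|)).
    move=> k; have /add_class_thru h := add_retract (Nr (enum_val k)) (add_refl M).
    exact: (thru_comp (u := dprod_proj L k) (v := dprod_inj L k) h).
  by move=> x; rewrite -[LHS](dprodE (x : dprod L)).
Qed.

End KrullSchmidt.

(** * Relative exact sequences *)

Section Relative.
Variables (A : nzRingType) (X : lmodType A).
(* the three finiteness properties of an Artin algebra on which the theory rests *)
Hypothesis noethA : forall (M : lmodType A) (S : M -> Prop),
  fin_gen M -> is_submodule S -> fg_submodule S.
Hypothesis dccA : forall M : lmodType A, fin_gen M -> dcc M.
Hypothesis hom_cover : forall M N : lmodType A, fin_gen M -> fin_gen N ->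
  exists n (p : {linear copies n M -> N}), lifts M p.
Hypothesis genX : additive_generator X.
Implicit Types M N K P Q S T U V W Z : lmodType A.

Notation F := (F_of (add_class X)).

Lemma fin_gen_inj U V (f : {linear U -> V}) : injective f -> fin_gen V -> fin_gen U.
Proof.
move=> fI /noethA/(_ (im_submod f))[e he].
have [||e' [_ se']] := @lspan_image_lift _ _ _ f (fun=> True) e => //.
  by move=> y /lspan_mem/he[x <-]; exists x.
apply/fin_gen_span; exists e' => x.
by have [|y sy /fI <-] := se' (f x); first by apply/he; exists x.
Qed.

Lemma fin_genX : fin_gen X. Proof. by case: genX. Qed.

(** [W] is a quotient of a power of [X]. *)
Lemma lifts_surj V W (g : {linear V -> W}) : fin_gen W -> lifts X g -> surjective g.
Proof.
move=> /(proj2 genX)[n [p ps]] hg w; have [y <-] := ps w.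
by have [p' p'E] := lifts_add (add_copies X n) hg p; exists (p' y).
Qed.

Lemma hom_exact_lifts Z U V W (f : {linear U -> V}) (g : {linear V -> W}) :
  short_exact f g -> (hom_exact Z f g <-> lifts Z g).
Proof.
move=> fg; have [fI fgE gs] := fg.
split=> [[_ _ h] w|hZ]; first by have [v vE] := h w; exists v.
split=> [u u' uu' z|v|w].
- by apply: fI; exact: uu'.
- split=> [gv|[u uv] z]; last by rewrite -uv /= (short_exactK fg).
  by have [|u uE] := @ex_cofactor _ _ _ _ f v fI; [by move=> z; apply/fgE|exists u].
- by have [v vE] := hZ w; exists v.
Qed.

(** Lifting maps from [X] suffices, as it passes to summands of powers. *)
Lemma F_intro U V W (f : {linear U -> V}) (g : {linear V -> W}) : fin_gen V ->
  injective f -> (forall v, g v = 0 <-> exists u, f u = v) -> fin_gen W ->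
  lifts X g -> F f g.
Proof.
move=> hV fI fgE hW gX; have gs := lifts_surj hW gX.
have fg : short_exact f g by [].
split=> //; first exact: fin_gen_inj fI hV.
by move=> Z XZ; apply/hom_exact_lifts => //; apply: lifts_add XZ gX.
Qed.

Lemma F_lifts U V W (f : {linear U -> V}) (g : {linear V -> W}) : F f g -> lifts X g.
Proof. by move=> [_ _ _ fg /(_ _ (add_refl X))/hom_exact_lifts-/(_ fg)]. Qed.

Lemma F_short_exact U V W (f : {linear U -> V}) (g : {linear V -> W}) : F f g -> short_exact f g.
Proof. by case. Qed.

Lemma F_kernel V W (g : {linear V -> W}) : fin_gen V -> fin_gen W -> lifts X g ->
  exists (U : lmodType A) (f : {linear U -> V}), F f g.
Proof.
move=> hV hW gX; have [U [f [fI fgE]]] := ex_kernel g.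
by exists U, f; apply: F_intro.
Qed.

Lemma F_projectiveP P : F_projective F P <->
  fin_gen P /\ forall U V W (f : {linear U -> V}) (g : {linear V -> W}), F f g -> lifts P g.
Proof.
split=> -[hP h]; split=> // U V W f g Ffg.
  exact/(hom_exact_lifts P (F_short_exact Ffg))/h/Ffg.
exact/(hom_exact_lifts P (F_short_exact Ffg))/h/Ffg.
Qed.

Lemma F_projective_add T M : F_projective F T -> add_class T M -> F_projective F M.
Proof.
move=> /F_projectiveP[hT pT] TM; apply/F_projectiveP; split; first exact: add_fin_gen TM.
by move=> U V W f g /pT; exact: lifts_add.
Qed.

Lemma F_projectiveX : F_projective F X.
Proof. by apply/F_projectiveP; split; [exact: fin_genX|move=> U V W f g /F_lifts]. Qed.

(** The vanishing of the Yoneda group Ext^1_F(M, N): pulling back along a map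
    from [M] shows that lifting it is splitting an F-exact sequence. *)
Definition Ext1_zero M N : Prop := forall V W (f : {linear N -> V}) (g : {linear V -> W}),
  F f g -> lifts M g.

Lemma Ext1_zero_add T M N : add_class T M -> Ext1_zero T N -> Ext1_zero M N.
Proof. by move=> TM h V W f g /h; exact: lifts_add. Qed.

Lemma Ext1_zero_prod M M' N : Ext1_zero M N -> Ext1_zero M' N -> Ext1_zero (M * M')%type N.
Proof. by move=> h h' V W f g Ffg; apply: lifts_prod; [exact: h Ffg|exact: h' Ffg]. Qed.

Lemma Ext1_zero_projective P N : F_projective F P -> Ext1_zero P N.
Proof. by move=> /F_projectiveP[_ h] V W f g; exact: h. Qed.

Lemma Ext1_zero_split M N V (f : {linear N -> V}) (g : {linear V -> M}) :
  Ext1_zero M N -> F f g -> retract M V.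
Proof.
by move=> h Ffg; have [s sE] := h _ _ _ _ Ffg (linid M); exists s, g.
Qed.

(** The cokernel of [K -> N * P]; a map from [X] to [M] lifts to it because it
    already lifts to [P]. *)
Lemma pushout K P M N (i : {linear K -> P}) (p : {linear P -> M}) (u : {linear K -> N}) :
  fin_gen N -> F i p ->
  exists (E : lmodType A) (j : {linear N -> E}) (v : {linear P -> E}) (q : {linear E -> M}),
    [/\ F j q, forall x, j (u x) = v (i x), forall x, q (v x) = p x
      & forall e, exists n x, e = j n + v x].
Proof.
move=> hN Fip; have [_ hP hM [iI ipE ps] _] := Fip.
have [E [w [ws wE]]] := ex_cokernel (pairing u (lin0 K P \- i)).
have w0 x : w (u x, - i x) = 0.
  by apply/wE; exists x; rewrite /= add0r.
have [q qE] : exists q : {linear E -> M}, forall x, q (w x) = p x.2.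
  apply: (@ex_factor _ _ _ _ w (p \o lsnd N P)) => // x /wE[y <-] /=.
  by rewrite add0r linearN (short_exactK (F_short_exact Fip)) oppr0.
pose j : {linear N -> E} := w \o pairing (linid N) (lin0 N P).
pose v : {linear P -> E} := w \o pairing (lin0 P N) (linid P).
have jv n x : j n + v x = w (n, x).
  have -> : (n, x) = (n, 0) + (0, x) :> (N * P)%type.
    by congr (_, _); rewrite ?addr0 ?add0r.
  by rewrite linearD.
have qv x : q (v x) = p x by rewrite qE.
have qj x : q (j x) = 0 by rewrite qE /= linear0.
exists E, j, v, q; split=> //; last first.
- by move=> e; have [[n x] <-] := ws e; exists n, x; rewrite jv.
- move=> x; apply/eqP; rewrite -subr_eq0 -linearN jv; apply/eqP; exact: w0.
apply: F_intro => //.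
- by apply: (fin_gen_surj ws); exact: fin_gen_prod.
- apply: linear_inj => n; rewrite -[j n]addr0 -[in j n + 0](linear0 v) jv => /wE[y].
  rewrite /= add0r => -[<- /eqP]; rewrite oppr_eq0 => /eqP iy0.
  have -> : y = 0 by apply: iI; rewrite linear0.
  by rewrite linear0.
- move=> e; split=> [|[n <-] //]; have [[n x] <-] := ws e.
  rewrite -jv linearD qj qv add0r => /ipE[y <-]; exists (n + u y).
  rewrite linearD; congr (_ + _); apply/eqP.
  by rewrite -subr_eq0 -linearN jv; apply/eqP; exact: w0.
- by move=> h; have [h' h'E] := F_lifts Fip h; exists (v \o h') => z; rewrite /= qv.
Qed.

(** The pushout of the sequence along [u] splits. *)
Lemma Ext1_zero_extend K P M N (i : {linear K -> P}) (p : {linear P -> M}) (u : {linear K -> N}) :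
  fin_gen N -> F i p -> Ext1_zero M N ->
  exists u' : {linear P -> N}, forall x, u' (i x) = u x.
Proof.
move=> hN Fip MN; have [E [j [v [q [Fjq ju qv _]]]]] := pushout u hN Fip.
have [s sE] := MN _ _ _ _ Fjq (linid M); have [jI jqE _] := F_short_exact Fjq.
have [|u' u'E] := @ex_cofactor _ _ _ _ j (v \- (s \o p)) jI.
  by move=> x; apply/jqE; rewrite /= linearB sE qv subrr.
exists u' => x; apply: jI; rewrite u'E /= ju.
by rewrite (short_exactK (F_short_exact Fip)) linear0 subr0.
Qed.

(** One F-projective presentation of [M] detects the vanishing of
    Ext^1_F(M, N): lift [M -> W] on [P], then correct the lift by an extension of
    the map [K -> N] that it induces. *)
Lemma Ext1_zero_of_extend K P M N (i : {linear K -> P}) (p : {linear P -> M}) :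
  F_projective F P -> F i p ->
  (forall u : {linear K -> N}, exists u' : {linear P -> N}, forall x, u' (i x) = u x) ->
  Ext1_zero M N.
Proof.
move=> /F_projectiveP[_ pP] Fip ext V W f g Ffg h.
have [fI fgE _] := F_short_exact Ffg; have [iI ipE ps] := F_short_exact Fip.
have [l lE] := pP _ _ _ _ _ Ffg (h \o p).
have [|u uE] := @ex_cofactor _ _ _ _ f (l \o i) fI.
  by move=> x; apply/fgE; rewrite /= lE /= (short_exactK (F_short_exact Fip)) linear0.
have [u' u'E] := ext u.
have [|h' h'E] := @ex_factor _ _ _ _ p (l \- (f \o u')) ps.
  by move=> _ /ipE[x <-]; rewrite /= u'E uE subrr.
exists h' => z; have [x <-] := ps z.
by rewrite h'E linearB /= (short_exactK (F_short_exact Ffg)) subr0 lE.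
Qed.

Lemma projective_presentation M : fin_gen M -> exists n (K : lmodType A)
  (i : {linear K -> copies n X}) (p : {linear copies n X -> M}), F i p.
Proof.
move=> hM; have [n [p hp]] := hom_cover fin_genX hM.
by have [K [i Fip]] := F_kernel (fin_gen_copies n fin_genX) hM hp; exists n, K, i, p.
Qed.

Lemma Ext1_zero_copies n M N : fin_gen M -> fin_gen N ->
  Ext1_zero M N -> Ext1_zero M (copies n N).
Proof.
move=> hM hN MN; have [m [K [i [p Fip]]]] := projective_presentation hM.
apply: (Ext1_zero_of_extend (F_projective_add F_projectiveX (add_copies X m)) Fip) => u.
have /ex_choice[u' u'E] : forall j, exists u' : {linear copies m X -> N},
    forall x, u' (i x) = u x j.
  move=> j; have [u' u'E] := Ext1_zero_extend (copies_proj N j \o u) hN Fip MN.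
  by exists u'.
by exists (tuple_map u') => x; apply/ffunP=> j; rewrite ffunE u'E.
Qed.

(** F-monomorphisms compose, and the cokernel of the composite contains that of
    the first one.  A map from [X] to the cokernel [N] is lifted modulo [W] first,
    then on [W]. *)
Lemma F_mono_comp U V W (E D : lmodType A) (f : {linear U -> V}) (g : {linear V -> W})
    (f' : {linear V -> E}) (g' : {linear E -> D}) : F f g -> F f' g' ->
  exists (N : lmodType A) (q : {linear E -> N}) (c : {linear W -> N}),
    [/\ F (lcomp f' f) q, injective c & forall v, c (g v) = q (f' v)].
Proof.
move=> Ffg Ffg'; have [_ _ _ [fI fgE gs] _] := Ffg.
have [_ hE _ [fI' fgE' gs'] _] := Ffg'.
have [N [q [qs qE]]] := ex_cokernel (lcomp f' f).
have [|c cE] := @ex_factor _ _ _ _ g (q \o f') gs.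
  by move=> _ /fgE[u <-]; apply/qE; exists u.
have {}cE v : c (g v) = q (f' v) by rewrite cE.
have [|d dE] := @ex_factor _ _ _ _ q g' qs.
  by move=> _ /qE[u <-]; rewrite /= (short_exactK (F_short_exact Ffg')).
exists N, q, c; split=> //; last first.
  apply: linear_inj => w; have [v <-] := gs w.
  by rewrite cE => /qE[u /fI' <-]; rewrite (short_exactK (F_short_exact Ffg)).
apply: F_intro => //; [by move=> x y /fI'/fI|exact: fin_gen_surj qs hE|].
move=> h; have [a aE] := F_lifts Ffg' (d \o h).
have [b bE] : exists b : {linear X -> W}, forall z, c (b z) = (h \- (q \o a)) z.
  apply: ex_cofactor => [|z].
    apply: linear_inj => w; have [v <-] := gs w.
    by rewrite cE => /qE[u /fI' <-]; rewrite (short_exactK (F_short_exact Ffg)).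
  have [e eE] := qs (h z); have /fgE'[v vE] : g' (e - a z) = 0.
    by rewrite linearB aE /= -eE dE subrr.
  by exists (g v); rewrite cE vE linearB eE.
have [l lE] := F_lifts Ffg b.
by exists ((f' \o l) \+ a) => z; rewrite /= linearD -cE lE bE /= subrK.
Qed.

(** * Minimal preenvelopes *)

Definition left_minimal Q S (f : {linear Q -> S}) : Prop :=
  forall phi : {linear S -> S}, (forall x, phi (f x) = f x) -> bijective phi.

(** By the descending chain condition there is a minimal summand of the
    preenvelope that contains the image of [Q]; by Fitting's lemma an
    endomorphism under [Q] which is not bijective would split off a smaller
    one. *)
Lemma ex_minimal_preenvelope C Q : F_torsion F C -> F_preenveloping F C -> fin_gen Q ->
  exists (S N : lmodType A) (f : {linear Q -> S}) (g : {linear S -> N}),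
    [/\ F f g, preenvelope C f & left_minimal f].
Proof.
move=> [_ Cq] Cp hQ; have [T [N0 [f0 [g0 [Ffg0 [CT envf0]]]]]] := Cp _ hQ.
have [_ hT _ [f0I fgE0 g0s] _] := Ffg0.
(* the summands of T through which f0 factors, given by their projections *)
pose D (S : T -> Prop) := exists e : {linear T -> T},
  [/\ forall x, e (f0 x) = f0 x, forall x, S (e x) & forall x, S x -> e x = x].
have [||S [hS [e [ef0 eS Se]] minS]] := dcc_min (P := D) (S0 := fun=> True) (dccA hT).
- by split.
- by exists (linid T).
have [U [inc [incI incE]]] := ex_submodule hS.
have [|r rE] := @ex_cofactor _ _ _ _ inc e incI; first by move=> x; apply/incE.
have einc u : e (inc u) = inc u by apply: Se; apply/incE; exists u.
have rinc u : r (inc u) = u by apply: incI; rewrite rE einc.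
have [|f fE] := @ex_cofactor _ _ _ _ inc f0 incI.
  by move=> x; apply/incE; rewrite -ef0.
have hU : fin_gen U by apply: (fin_gen_surj (g := r)) hT => u; exists (inc u).
have CU : C U.
  have rX : lifts X r by move=> h; exists (inc \o h) => z; rewrite /= rinc.
  by have [K [i /Cq]] := F_kernel hT hU rX; apply.
have [N [g [gs gE]]] := ex_cokernel f.
exists U, N, f, g; split.
- apply: F_intro => //; first by move=> x y fxy; apply: f0I; rewrite -!fE fxy.
    exact: fin_gen_surj gs hU.
  have [|d dE] := @ex_factor _ _ _ _ g (g0 \o inc) gs.
    by move=> _ /gE[x <-]; rewrite /= fE; apply/fgE0; exists x.
  move=> h; have [l lE] := F_lifts Ffg0 (d \o h); exists (r \o l) => z.
  have [u uE] := gs (h z); rewrite /= -uE.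
  have /fgE0[x xE] : g0 (l z - inc u) = 0.
    by rewrite linearB lE /= -uE dE subrr.
  have -> : r (l z) = f x + u.
    apply: incI; rewrite linearD fE rE.
    by rewrite -[l z](subrK (inc u)) -xE linearD ef0 einc.
  by rewrite linearD (proj2 (gE _)) ?add0r //; exists x.
- split=> // Z CZ h; have [h' h'E] := envf0 Z CZ h.
  by exists (h' \o inc) => x; rewrite /= fE; exact: h'E.
- move=> phi phif; apply: (surj_endo_bij noethA dccA) => // u.
  have [m [e' [m0 e'im e'E _]]] := fitting noethA dccA phi hU.
  (* the image of phi ^ m is a summand of T through which f0 factors *)
  pose S' x := exists u, inc (iter m phi u) = x.
  have iterf n x : iter n phi (f x) = f x by elim: n => //= n ->.
  have [||||v vE] := minS S' _ _ _ (inc u).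
  + exact: (im_submod (lcomp inc (lpow phi m))).
  + exists (inc \o (e' \o r)); split=> x.
    * by rewrite /= -fE rinc -[f x](iterf m) e'E.
    * by have [y yE] := e'im (r x); exists y; rewrite /= yE.
    * by move=> [w <-]; rewrite /= rinc e'E.
  + by move=> _ [w <-]; apply/incE; eexists.
  + by apply/incE; exists u.
  case: m m0 vE {e'im e'E S'} => // m _ /incI vE.
  by exists (iter m phi v).
Qed.

(** Pulling back along [r] produces an extension of [S] by [Z], which lies in
    [C]; minimality turns the extension of [l] to it into a section. *)
Lemma minimal_lift C Q S Z V W (f : {linear Q -> S})
    (a : {linear Z -> V}) (b : {linear V -> W}) (r : {linear S -> W}) (l : {linear Q -> V}) :
  F_torsion F C -> in_mod C -> preenvelope C f -> left_minimal f -> C Z -> F a b ->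
  (forall x, b (l x) = r (f x)) ->
  exists t : {linear S -> V}, (forall s, b (t s) = r s) /\ (forall x, t (f x) = l x).
Proof.
move=> [Ce _] Cm [CS env] min CZ Fab blr.
have [_ hV _ [aI abE bs] _] := Fab.
(* G is the pullback of b and r, and z : Z -> G its kernel over S *)
pose d : {linear (V * S)%type -> W} := copair b (\- r).
have [G [i [iI iE]]] := ex_kernel d.
have dE v s : d (v, s) = 0 <-> b v = r s.
  rewrite /d /=; split=> [/eqP|->]; last by rewrite subrr.
  by rewrite subr_eq0 => /eqP.
have [|z zE] := @ex_cofactor _ _ _ _ i (pairing a (lin0 Z S)) iI.
  by move=> x; apply/iE/dE; rewrite linear0 (short_exactK (F_short_exact Fab)).
have [|j jE] := @ex_cofactor _ _ _ _ i (pairing l f) iI.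
  by move=> x; apply/iE/dE.
have hS := Cm _ CS.
have iP w : b (i w).1 = r (i w).2.
  by apply/dE; rewrite -surjective_pairing; apply/iE; exists w.
have CG : C G.
  apply: (Ce _ _ _ z (lsnd V S \o i)) => //; apply: F_intro => //.
  - exact: fin_gen_inj iI (fin_gen_prod hV hS).
  - by move=> x y zxy; apply: aI; have := congr1 i zxy; rewrite !zE => -[].
  - move=> w; split=> [/= w2|[x <-]]; last by rewrite /= zE.
    have /abE[x xE] : b (i w).1 = 0 by rewrite iP w2 linear0.
    by exists x; apply: iI; rewrite zE /= xE [RHS]surjective_pairing w2.
  - move=> h; have [h' h'E] := F_lifts Fab (r \o h).
    have [|q qE] := @ex_cofactor _ _ _ _ i (pairing h' h) iI.
      by move=> x; apply/iE/dE; rewrite h'E.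
    by exists q => x; rewrite /= qE.
have [h jhE] := env G CG j.
have hE x : h (f x) = j x by exact: jhE.
have phif x : (lsnd V S \o i \o h) (f x) = f x.
  by rewrite /= hE jE.
have [psi [psiK Kpsi]] := ex_inverse (min (lcomp (lcomp (lsnd V S) i) h) phif).
have psif x : psi (f x) = f x by rewrite -[in LHS](phif x); exact: psiK.
exists (lfst V S \o i \o h \o psi); split=> [s|x] /=.
  by rewrite iP; congr (r _); exact: Kpsi.
by rewrite psif hE jE.
Qed.

(** * Ext-projective modules and the tilting criterion *)

Definition ext_projective (C : modclass A) M : Prop := forall Z, C Z -> Ext1_zero M Z.

(** A map from [S] is lifted after a lift on the F-projective [Q]; a map from [N]
    is lifted as a map from [S] that vanishes on [Q]. *)
Lemma minimal_ext_projective C Q S N (f : {linear Q -> S}) (g : {linear S -> N}) :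
  F_torsion F C -> in_mod C -> F_projective F Q -> F f g ->
  preenvelope C f -> left_minimal f -> ext_projective C S /\ ext_projective C N.
Proof.
move=> Ct Cm /F_projectiveP[_ pQ] Ffg env min.
have [_ fgE gs] := F_short_exact Ffg.
split=> Z CZ V W a b Fab h.
  have [l lE] := pQ _ _ _ _ _ Fab (h \o f).
  by have [t [tE _]] := minimal_lift Ct Cm env min CZ Fab lE; exists t.
have [|t [tE tf]] := minimal_lift (r := h \o g) (l := lin0 Q V) Ct Cm env min CZ Fab.
  by move=> x; rewrite /= (short_exactK (F_short_exact Ffg)) !linear0.
have [|h' h'E] := @ex_factor _ _ _ _ g t gs; first by move=> _ /fgE[x <-]; exact: tf.
by exists h' => n; have [s <-] := gs n; rewrite h'E tE.
Qed.

Lemma F_torsion_add C T M : F_torsion F C -> in_mod C -> C T -> add_class T M -> C M.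
Proof.
move=> [Ce Cq] Cm CT TM.
have quot V W (g : {linear V -> W}) : C V -> lifts X g -> surjective g -> C W.
  move=> CV gX gs; have [U [f Ffg]] := F_kernel (Cm _ CV) (fin_gen_surj gs (Cm _ CV)) gX.
  exact: Cq Ffg CV.
have prod V W : C V -> C W -> C (V * W)%type.
  move=> CV CW; apply: (Ce _ _ _ (pairing (linid V) (lin0 V W)) (lsnd V W)) => //.
  apply: F_intro => //; first exact: fin_gen_prod (Cm _ CV) (Cm _ CW).
  - by move=> x y [].
  - by move=> [v w]; split=> [/= ->|[x [_ <-]]] //; exists v.
  - exact: Cm.
  - by move=> h; exists (pairing (lin0 X V) h).
have retr V W : C V -> retract W V -> C W.
  move=> CV [i [p ip]]; apply: (quot V W p) => // [h|w]; last by exists (i w).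
  by exists (i \o h) => z; rewrite /= ip.
have cop n : C (copies n T).
  elim: n => [|n IH].
    apply: (retr T) => //; exists (lin0 _ _), (lin0 _ _) => x.
    by apply/ffunP=> -[].
  apply: (retr (T * copies n T)%type); first exact: prod.
  exists (pairing (copies_proj T ord0) (tuple_map (fun i => copies_proj T (lift ord0 i)))),
    (copair (copies_inj T ord0) (sum_map (fun i => copies_inj T (lift ord0 i)))) => y.
  rewrite /= [RHS]copies_sum big_ord_recl; congr (_ + _).
  by apply: eq_bigr => i _; rewrite ffunE.
by have /add_classP[n] := TM; exact: retr.
Qed.

(** Every [V] embeds into a member of [C], whose quotients by submodules of [V]
    belong to [C] again: these play the part of F-injectives, and dimension
    shifting gives Ext^2_F(T, -) = 0. *)
Lemma F_kernel_projective C K P T (i : {linear K -> P}) (p : {linear P -> T}) :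
  F_torsion F C -> in_mod C -> F_preenveloping F C -> ext_projective C T ->
  F_projective F P -> F i p -> F_projective F K.
Proof.
move=> [_ Cq] Cm Cp TC /F_projectiveP[_ pP] Fip.
have hK : fin_gen K by case: Fip.
apply/F_projectiveP; split=> // U V W f g Ffg h.
have hV : fin_gen V by case: Ffg.
have [E [D [f' [g' [Ffg' [CE _]]]]]] := Cp _ hV.
have [N [q [c [Fq cI cE]]]] := F_mono_comp Ffg Ffg'.
have CN : C N := Cq _ _ _ _ _ Fq CE.
have [u uE] := Ext1_zero_extend (c \o h) (Cm _ CN) Fip (TC _ CN).
have [l lE] := pP _ _ _ _ _ Fq u.
have [fI' fgE' _] := F_short_exact Ffg'.
have [_ qE _] := F_short_exact Fq.
have [_ fgE gs] := F_short_exact Ffg.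
have [|h' h'E] := @ex_cofactor _ _ _ _ f' (l \o i) fI'.
  move=> x; have [v vE] := gs (h x).
  have /qE[y yE] : q (l (i x) - f' v) = 0.
    by rewrite linearB lE uE -cE vE subrr.
  by exists (f y + v); rewrite linearD /= -[f' (f y)]/((f' \o f) y) yE subrK.
by exists h' => x; apply: cI; rewrite cE h'E /= lE uE.
Qed.

Lemma F_projective_syzygy K P Q (i : {linear K -> P}) (p : {linear P -> Q}) :
  F_projective F P -> F_projective F Q -> F i p -> F_projective F K.
Proof.
move=> hP /(@Ext1_zero_projective _ K) hQ Fip; have [hK _ _ _ _] := Fip.
have [r rE] := Ext1_zero_extend (linid K) hK Fip hQ.
apply: F_projective_add hP _; apply: add_retract (add_refl P).
by exists i, r.
Qed.

(** By [F_kernel_projective] all syzygies of [T] are F-projective, so the higher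
    Ext groups vanish for every resolution and there is one of length one. *)
Lemma tilting_criterion C T : F_torsion F C -> in_mod C -> F_preenveloping F C ->
  C T -> ext_projective C T ->
  (forall Q, F_projective F Q -> exists (T0 T1 : lmodType A)
     (f : {linear Q -> T0}) (g : {linear T0 -> T1}),
     [/\ add_class T T0, add_class T T1 & F f g]) ->
  F_tilting F T.
Proof.
move=> Ct Cm Cp CT TC cores; have hT := Cm _ CT; split=> //.
- have [n [K [i [p Fip]]]] := projective_presentation hT.
  have pX := F_projective_add F_projectiveX (add_copies X n).
  have pK := F_kernel_projective Ct Cm Cp TC pX Fip.
  pose Z : lmodType A := copies 0 X.
  have Z0 (x : Z) : x = 0 by apply/ffunP=> -[].
  have pZ : F_projective F Z := F_projective_add F_projectiveX (add_copies X 0).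
  have hZ := proj1 pZ; have hK := proj1 pK.
  have Fid M : fin_gen M -> F (lin0 Z M) (linid M).
    move=> hM; apply: F_intro => // [x y _|x|h]; first by rewrite (Z0 x) (Z0 y).
      by split=> [/= ->|[z <-] //]; exists 0.
    by exists h.
  pose term j : lmodType A := match j with 0 => copies n X | 1 => K | _ => Z end.
  pose syz j : lmodType A := match j with 0 => K | _ => Z end.
  pose incl j : {linear syz j -> term j} :=
    match j with 0 => i | 1 => lin0 Z K | _ => lin0 Z Z end.
  pose cover j : {linear term j.+1 -> syz j} :=
    match j with 0 => linid K | _ => linid Z end.
  have termP j : F_projective F (term j) by case: j => [|[|j]].
  have coverF j : F (incl j.+1) (cover j).
    by case: j => [|j]; [exact: Fid hK|exact: Fid hZ].
  exists (@FResolution _ F T term syz incl p cover termP Fip coverF).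
  by move=> [|[|j]].
- move=> [//|j] _ P f fc.
  have pterm n : F_projective F (rterm P n) := term_projective P n.
  have psyz n : F_projective F (rsyz P n).
    elim: n => [|n IH].
      exact: (F_kernel_projective Ct Cm Cp TC (pterm 0%N) (aug_exact P)).
    exact: (F_projective_syzygy (pterm n.+1) IH (cover_exact P n)).
  have [_ cE cs] := F_short_exact (cover_exact P j).
  have [|f' f'E] := @ex_factor _ _ _ _ (rcover P j) f cs.
    move=> _ /cE[y <-]; have [_ _ cs'] := F_short_exact (cover_exact P j.+1).
    by have [x <-] := cs' y; exact: fc.
  have [g gE] : exists g : {linear rterm P j -> T}, forall x, g (rincl P j x) = f' x.
    case: j f' {f fc cE cs f'E} => [|j] f'.
      exact: (Ext1_zero_extend f' hT (aug_exact P) (TC _ CT)).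
    exact: (Ext1_zero_extend f' hT (cover_exact P j) (Ext1_zero_projective (psyz j))).
  by exists g => x; rewrite /= gE f'E.
Qed.

Lemma gen_FP T Z : fin_gen T -> gen_F F T Z <->
  fin_gen Z /\ exists n (p : {linear copies n T -> Z}), lifts X p.
Proof.
move=> hT; split=> [[n [K [f [g Ffg]]]]|[hZ [n [p hp]]]].
  by split; [case: Ffg|exists n, g; exact: F_lifts Ffg].
by have [K [f Ffg]] := F_kernel (fin_gen_copies n hT) hZ hp; exists n, K, f, p.
Qed.

Lemma gen_F_add T M Z (p : {linear M -> Z}) : fin_gen T -> fin_gen Z ->
  add_class T M -> lifts X p -> gen_F F T Z.
Proof.
move=> hT hZ /add_classP[n [i [r ir]]] hp; apply/gen_FP => //; split=> //.
exists n, (lcomp p r); apply: lifts_comp => // h.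
by exists (i \o h) => z; rewrite /= ir.
Qed.

(** Components of a cover of [M] by a power of [X] extend to [T0], and the
    resulting map from a power of [T0] is again a cover. *)
Lemma extend_cover T0 M (f : {linear X -> T0}) : fin_gen M ->
  (forall u : {linear X -> M}, exists u' : {linear T0 -> M}, forall x, u' (f x) = u x) ->
  exists n (p : {linear copies n T0 -> M}), lifts X p.
Proof.
move=> hM ext; have [n [p hp]] := hom_cover fin_genX hM.
have /ex_choice[u uE] : forall j, exists u' : {linear T0 -> M},
    forall x, u' (f x) = p (copies_inj X j x).
  by move=> j; have [u' u'E] := ext (lcomp p (copies_inj X j)); exists u'.
exists n, (sum_map u) => h; have [h' h'E] := hp h.
exists (tuple_map (fun j => lcomp f (lcomp (copies_proj X j) h'))) => z.
rewrite -h'E /= [h' z in RHS]copies_sum linear_sum; apply: eq_bigr => j _.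
by rewrite ffunE -uE.
Qed.

(** The piece Hom(T, N) -> Hom(T, M) -> Ext^1_F(T, K) -> Ext^1_F(T, N) of the
    long exact sequence. *)
Lemma Ext1_zero_kernel T N K M (i : {linear K -> N}) (p : {linear N -> M}) :
  fin_gen T -> F i p -> lifts T p -> Ext1_zero T N -> Ext1_zero T K.
Proof.
move=> hT Fip Tp TN; have [n [L [j [q Fjq]]]] := projective_presentation hT.
have [_ hN _ [iI ipE _] _] := Fip; have [_ _ _ [_ jqE qs] _] := Fjq.
apply: (Ext1_zero_of_extend (F_projective_add F_projectiveX (add_copies X n)) Fjq) => u.
have [v vE] := Ext1_zero_extend (lcomp i u) hN Fjq TN.
have [|w wE] := @ex_factor _ _ _ _ q (lcomp p v) qs.
  by move=> _ /jqE[x <-]; rewrite /= vE (short_exactK (F_short_exact Fip)).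
have [w' w'E] := Tp w.
have [|u' u'E] := @ex_cofactor _ _ _ _ i (v \- lcomp w' q) iI.
  by move=> x; apply/ipE; rewrite /= linearB w'E wE subrr.
exists u' => x; apply: iI; rewrite u'E /= vE.
by rewrite (short_exactK (F_short_exact Fjq)) linear0 subr0.
Qed.

(** Cover [S] by a power of [T] along which all maps from [T] lift.  The kernel
    [K] satisfies Ext^1_F(T, K) = 0; extending a cover of [K] by [X] along
    [X -> T0] then shows that it lies in [C], so the cover of [S] splits. *)
Lemma ext_projective_add C T T0 T1 S (f : {linear X -> T0}) (g : {linear T0 -> T1}) :
  F_torsion F C -> in_mod C -> C T -> ext_projective C T ->
  add_class T T0 -> add_class T T1 -> F f g ->
  C S -> ext_projective C S -> add_class T S.
Proof.
move=> Ct Cm CT TC TT0 TT1 Ffg CS SC.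
have hT := Cm _ CT; have hS := Cm _ CS.
have cov M : fin_gen M -> Ext1_zero T M -> exists n (p : {linear copies n T0 -> M}), lifts X p.
  move=> hM TM; apply: (extend_cover (f := f)) => // u.
  exact: (Ext1_zero_extend u hM Ffg (Ext1_zero_add TT1 TM)).
have [n [rho Trho]] := hom_cover hT hS.
have Xrho : lifts X rho.
  have [m [p hp]] := cov S hS (TC _ CS).
  have [q qE] := lifts_add (add_trans TT0 (add_copies T0 m)) Trho p.
  apply: (@lifts_of_comp _ _ _ _ _ q) => h; have [h' h'E] := hp h.
  by exists h' => z; rewrite /= qE.
have [K [i Fi]] := F_kernel (fin_gen_copies n hT) hS Xrho.
have hK : fin_gen K by case: Fi.
have TK := Ext1_zero_kernel hT Fi Trho (Ext1_zero_copies (n:=n) hT hT (TC _ CT)).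
have [m [p hp]] := cov K hK TK.
have CK : C K.
  have CT0 : C (copies m T0).
    exact: F_torsion_add Ct Cm CT (add_trans TT0 (add_copies T0 m)).
  have [L [j Fj]] := F_kernel (Cm _ CT0) hK hp.
  by case: Ct => _ Cq; exact: Cq Fj CT0.
exact: add_retract (Ext1_zero_split (SC _ CK) Fi) (add_copies T n).
Qed.

(** * The class generated by a tilting module *)

Section Tilting.
Variable T : lmodType A.
Hypothesis tiltT : F_tilting F T.

Let hT : fin_gen T. Proof. by case: tiltT. Qed.

(** In a resolution without terms beyond degree one, the first syzygy is
    isomorphic to the term of degree one. *)
Lemma tilting_presentation : exists (K P : lmodType A)
    (i : {linear K -> P}) (p : {linear P -> T}),
  [/\ F_projective F K, F_projective F P & F i p].
Proof.
have [_ [P Pz] _ _] := tiltT.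
exists (rsyz P 0), (rterm P 0), (rincl P 0), (raug P); split.
- apply: F_projective_add (term_projective P 1) _; apply: add_retract (add_refl _).
  have [_ cE cs] := F_short_exact (cover_exact P 0).
  have [_ _ cs'] := F_short_exact (cover_exact P 1).
  have cI : injective (rcover P 0).
    apply: linear_inj => x /cE[y <-]; have [z <-] := cs' y.
    by rewrite (Pz 2%N isT z) !linear0.
  by have [d [_ dK]] := ex_inverse (inj_surj_bij cI cs); exists d, (rcover P 0).
- exact: term_projective.
- exact: aug_exact.
Qed.

Lemma tilting_Ext1_zero_self : Ext1_zero T T.
Proof.
have [_ [P _] /(_ 1%N isT)/(_ P) E _] := tiltT.
apply: (Ext1_zero_of_extend (term_projective P 0) (aug_exact P)) => u.
have [|g gE] := E (u \o rcover P 0).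
  by move=> x; rewrite /= (short_exactK (F_short_exact (cover_exact P 0))) linear0.
have [_ _ cs] := F_short_exact (cover_exact P 0).
by exists g => x; have [y <-] := cs x; rewrite -[RHS]/((u \o rcover P 0) y) gE.
Qed.

(** A map from the F-projective kernel of a presentation of [T] to a quotient of
    [T ^ n] lifts to [T ^ n], where it extends. *)
Lemma tilting_Ext1_zero_gen : ext_projective (gen_F F T) T.
Proof.
move=> Z /(gen_FP _ hT)[hZ [n [q hq]]].
have [K [P [i [p [pK pP Fip]]]]] := tilting_presentation.
apply: (Ext1_zero_of_extend pP Fip) => u.
have [L [j Fj]] := F_kernel (fin_gen_copies n hT) hZ hq.
have /F_projectiveP[_ /(_ _ _ _ _ _ Fj u)[v vE]] := pK.
have TTn := Ext1_zero_copies (n := n) hT hT tilting_Ext1_zero_self.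
have [v' v'E] := Ext1_zero_extend v (fin_gen_copies n hT) Fip TTn.
by exists (q \o v') => x; rewrite /= v'E vE.
Qed.

Lemma gen_F_in_mod : in_mod (gen_F F T).
Proof. by move=> M /(gen_FP _ hT)[]. Qed.

Lemma gen_F_torsion : F_torsion F (gen_F F T).
Proof.
split=> U V W f g Ffg; have [_ hV hW [fI fgE gs] _] := Ffg; last first.
  move=> /(gen_FP _ hT)[_ [n [p hp]]].
  exact: gen_F_add hT hW (add_copies T n) (lifts_comp hp (F_lifts Ffg)).
move=> genU /(gen_FP _ hT)[_ [m [q hq]]].
have /(gen_FP _ hT)[_ [n [p hp]]] := genU.
have [q' q'E] := Ext1_zero_add (add_copies T m) (tilting_Ext1_zero_gen genU) Ffg q.
apply: (gen_F_add (p := copair (lcomp f p) q') hT hV).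
  exact: add_prod (add_copies T n) (add_copies T m).
move=> h; have [a aE] := hq (g \o h).
have [|b bE] := @ex_cofactor _ _ _ _ f (h \- (q' \o a)) fI.
  by move=> z; apply/fgE; rewrite linearB /= q'E aE subrr.
have [c cE] := hp b; exists (pairing c a) => z.
by rewrite /= cE bE /= subrK.
Qed.

(** Pushing a coresolution 0 -> X ^ n -> T0 -> T1 -> 0 out along a cover
    X ^ n -> M gives M -> Y; here Y is an F-quotient of T0, and the cokernel T1
    has no extensions by members of the class. *)
Lemma gen_F_preenveloping : F_preenveloping F (gen_F F T).
Proof.
move=> M hM; have [n [K [i [p Fip]]]] := projective_presentation hM.
have [_ _ _ /(_ _ (F_projective_add F_projectiveX (add_copies X n)))] := tiltT.
move=> [T0 [T1 [f [g [TT0 TT1 Ffg]]]]].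
have [Y [j [v [q [Fjq ju qv Yjv]]]]] := pushout p hM Ffg.
have hY : fin_gen Y by case: Fjq.
exists Y, T1, j, q; split=> //; split; last first.
  move=> Z genZ h; have hZ := gen_F_in_mod genZ.
  have [h' h'E] := Ext1_zero_extend h hZ Fjq (Ext1_zero_add TT1 (tilting_Ext1_zero_gen genZ)).
  by exists h'.
apply: (gen_F_add (p := v) hT hY TT0) => h.
have [a aE] := F_lifts Ffg (q \o h); have [jI jqE _] := F_short_exact Fjq.
have [|b bE] := @ex_cofactor _ _ _ _ j (h \- (v \o a)) jI.
  by move=> z; apply/jqE; rewrite linearB /= qv aE subrr.
have [c cE] := F_lifts Fip b.
exists ((f \o c) \+ a) => z.
by rewrite linearD /= -ju cE bE /= subrK.
Qed.

Lemma tilting_in_gen : gen_F F T T.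
Proof.
apply: (gen_F_add (p := linid T) hT hT (add_refl T)) => h.
by exists h.
Qed.

End Tilting.

(** * The correspondence *)

Lemma generator_nonzero : ~ zero_module X.
Proof.
move=> X0; have hA : fin_gen (A^o : lmodType A).
  by exists 1%N, (fun=> 1) => x; exists (fun=> x); rewrite big_ord1 -[LHS]mulr1.
have [_ gen] := genX; have [n [p ps]] := proj2 (gen _) hA.
have [y yE] := ps (1 : A); have /negP := oner_neq0 A; apply; apply/eqP.
rewrite -[LHS]yE -[RHS](linear0 p); congr (p _).
by apply/ffunP => i; rewrite ffunE; exact: X0.
Qed.

Lemma same_classE (C D : modclass A) : same_class C D -> C = D.
Proof. by move=> CD; apply: funext => M; apply/propext. Qed.

Lemma gen_F_isomorphic T T' : F_tilting F T -> F_tilting F T' ->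
  isomorphic T T' -> same_class (gen_F F T) (gen_F F T').
Proof.
have sub U U' : F_tilting F U -> F_tilting F U' -> isomorphic U U' ->
    forall M, gen_F F U M -> gen_F F U' M.
  move=> [hU _ _ _] [hU' _ _ _] UU' M /(gen_FP _ hU)[hM [n [p hp]]].
  apply: (gen_F_add (p := p)) => //.
  apply: add_trans (add_copies U n).
  exact: add_retract (isomorphic_retract UU') (add_refl U').
by move=> tT tT' TT' M; split; apply: sub => //; exact: isomorphic_sym.
Qed.

Lemma tilting_gen_add T T' : F_tilting F T -> F_tilting F T' ->
  same_class (gen_F F T) (gen_F F T') -> add_class T T'.
Proof.
move=> tT tT' /same_classE E.
have [hT _ _ /(_ _ (F_projectiveX))[T0 [T1 [f [g [TT0 TT1 Ffg]]]]]] := tT.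
have Tt := gen_F_torsion tT.
apply: (ext_projective_add Tt _ _ _ TT0 TT1 Ffg).
- exact: gen_F_in_mod.
- exact: tilting_in_gen.
- exact: tilting_Ext1_zero_gen.
- by rewrite E; exact: tilting_in_gen.
- by rewrite E; exact: tilting_Ext1_zero_gen.
Qed.

Lemma gen_F_injective T T' : basic T -> F_tilting F T -> basic T' -> F_tilting F T' ->
  same_class (gen_F F T) (gen_F F T') -> isomorphic T T'.
Proof.
move=> bT tT bT' tT' E.
have [[hT _ _ _] [hT' _ _ _]] := (tT, tT').
apply: basic_add_isomorphic => //; apply: tilting_gen_add => //.
by move=> M; rewrite E.
Qed.

(** The tilting module is the basic part of the sum of a minimal preenvelope of
    [X] and its cokernel. *)
Lemma gen_F_surjective (C : modclass A) :
  in_mod C -> F_torsion F C -> F_preenveloping F C ->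
  exists T, [/\ basic T, F_tilting F T & same_class C (gen_F F T)].
Proof.
move=> Cm Ct Cp; have pX := F_projectiveX; have [Ce Cq] := Ct.
have cores Q : F_projective F Q -> exists (S N : lmodType A)
    (f : {linear Q -> S}) (g : {linear S -> N}),
    [/\ F f g, preenvelope C f, C N, ext_projective C S & ext_projective C N].
  move=> pQ; have [hQ _] := pQ.
  have [S [N [f [g [Ffg env min]]]]] := ex_minimal_preenvelope Ct Cp hQ.
  have [SC NC] := minimal_ext_projective Ct Cm pQ Ffg env min.
  by exists S, N, f, g; split=> //; apply: Cq Ffg _; case: env.
have [S [N [f [g [Ffg [CS env] CN SC NC]]]]] := cores X pX.
pose T0 : lmodType A := (S * N)%type.
have hT0 : fin_gen T0 := fin_gen_prod (Cm _ CS) (Cm _ CN).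
have CT0 : C T0.
  apply: (Ce _ _ _ (pairing (linid S) (lin0 S N)) (lsnd S N)) => //.
  apply: (F_intro) => //.
  - by move=> x y [].
  - by move=> [x y]; split=> [/= ->|[z [_ <-]]] //; exists x.
  - exact: Cm.
  - by move=> h; exists (pairing (lin0 X S) h).
have T0C : ext_projective C T0.
  by move=> Z CZ; exact: Ext1_zero_prod (SC _ CZ) (NC _ CZ).
have [|B [bB T0B BT0]] := ex_basic_part dccA hT0.
  move=> T00; apply: (generator_nonzero) => x.
  have [_ _ _ [fI _ _] _] := Ffg; apply: fI.
  by have /(congr1 fst) /= -> := T00 (f x, 0); rewrite linear0.
have CB : C B by exact: (F_torsion_add Ct Cm CT0 T0B).
have BC : ext_projective C B by move=> Z CZ; exact: Ext1_zero_add T0B (T0C _ CZ).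
have BS : add_class B S := add_trans BT0 (add_prodl S N).
have BN : add_class B N := add_trans BT0 (add_prodr S N).
have hB := Cm _ CB.
exists B; split=> // [|Z].
  apply: (tilting_criterion Ct Cm Cp CB BC) => Q pQ.
  have [S' [N' [f' [g' [Ff' [CS' _] CN' SC' NC']]]]] := cores Q pQ.
  have inB := ext_projective_add Ct Cm CB BC BS BN Ffg.
  by exists S', N', f', g'; split=> //; exact: inB.
split=> [CZ|/(gen_FP _ hB)[hZ [n [p hp]]]].
  have hZ := Cm _ CZ.
  have [|n [p hp]] := extend_cover (f := f) hZ; first exact: env.
  exact: (gen_F_add hB hZ (add_trans BS (add_copies S n)) hp).
have CBn : C (copies n B) by exact: (F_torsion_add Ct Cm CB (add_copies B n)).
have [K [i Fi]] := F_kernel (Cm _ CBn) hZ hp.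
exact: Cq Fi CBn.
Qed.

End Relative.

Theorem theorem1p3
  (k : comNzRingType) (A : algType k) (X : lmodType A)
  (hA : artin_algebra A) (hX : additive_generator X) :
  let F := F_of (add_class X) in
  (forall C : modclass A, in_mod C ->
     (F_preenveloping F C /\ F_torsion F C) <->
     (exists T : lmodType A, F_tilting F T /\ same_class C (gen_F F T))) /\
  (* T |-> gen_F(T) is well defined on isomorphism classes, with values in the
     F-torsion F-preenveloping classes, injective and surjective *)
  [/\ forall T T' : lmodType A,
        basic T -> F_tilting F T -> basic T' -> F_tilting F T' ->
        isomorphic T T' -> same_class (gen_F F T) (gen_F F T'),
      forall T : lmodType A, basic T -> F_tilting F T ->
        [/\ in_mod (gen_F F T), F_torsion F (gen_F F T)
          & F_preenveloping F (gen_F F T)],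
      forall T T' : lmodType A,
        basic T -> F_tilting F T -> basic T' -> F_tilting F T' ->
        same_class (gen_F F T) (gen_F F T') -> isomorphic T T'
    & forall C : modclass A,
        in_mod C -> F_torsion F C -> F_preenveloping F C ->
        exists T : lmodType A,
          [/\ basic T, F_tilting F T & same_class C (gen_F F T)]].
Proof.
move=> F.
have noethA := fin_gen_noetherian hA.
have dccA := fin_gen_dcc hA.
have cover (M N : lmodType A) := @ex_hom_cover k A hA M N.
have mod T (tT : F_tilting F T) := gen_F_in_mod noethA hX tT.
have tors T (tT : F_tilting F T) := gen_F_torsion noethA cover hX tT.
have preenv T (tT : F_tilting F T) := gen_F_preenveloping noethA cover hX tT.
split=> [C Cm|].
  split=> [[Cp Ct]|[T [tT /same_classE ->]]]; last by split; [exact: preenv|exact: tors].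
  have [T [_ tT CT]] := gen_F_surjective noethA dccA cover hX Cm Ct Cp.
  by exists T.
split.
- by move=> T T' _ tT _ tT'; exact: gen_F_isomorphic.
- by move=> T _ tT; split; [exact: mod|exact: tors|exact: preenv].
- exact: gen_F_injective.
- exact: gen_F_surjective.
Qed.
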